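(* Let $H(x,p)=\sigma(x)m(|p|)$ for $(x,p)\in\mathbf{T}^N\times\mathbf{R}^N$, where $\sigma:\mathbf{T}^N\to(0,\infty)$ is continuous, $m:[0,\infty)\to(0,1)$ is Lipschitz continuous and strictly increasing, and $m(r)\to1$ as $r\to\infty$. Let $\overline{\sigma}=\max_{\mathbf{T}^N}\sigma$, $\underline{\sigma}=\min_{\mathbf{T}^N}\sigma$, let $\bar{H}_\infty$ be the generalized effective Hamiltonian of $H$ and $\mathcal{D}$ the solvability set of $H$. Let $T>0$ and let $u_0:\mathbf{R}^N\to\mathbf{R}$ be bounded and Lipschitz continuous with Lipschitz constant $\mathrm{Lip}[u_0]$. Assume either $$(1)\ \ \mathcal{D}=\mathbf{R}^N\qquad\text{or}\qquad(2)\ \ m(\mathrm{Lip}[u_0])<\underline{\sigma}/\overline{\sigma}.$$ For $\varepsilon>0$ let $u^\varepsilon\in C(\mathbf{R}^N\times[0,T))$ be the unique bounded viscosity solution of $$u^\varepsilon_t(x,t)+H\left(\frac{x}{\varepsilon},Du^\varepsilon(x,t)\right)=0\ \text{ in }\mathbf{R}^N\times(0,T),\qquad u^\varepsilon(x,0)=u_0(x)\ \text{ in }\mathbf{R}^N,$$ and let $u\in C(\mathbf{R}^N\times[0,T))$ be the unique bounded viscosity solution of $$u_t(x,t)+\bar{H}_\infty(Du(x,t))=0\ \text{ in }\mathbf{R}^N\times(0,T),\qquad u(x,0)=u_0(x)\ \text{ in }\mathbf{R}^N.$$ Then $u^\varepsilon$ converges to $u$ locally uniformly in $\mathbf{R}^N\times[0,T)$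 as $\varepsilon\to0$.
   Context: $\mathbf{T}^N=\mathbf{R}^N/\mathbf{Z}^N$; functions on $\mathbf{T}^N$ are identified with $\mathbf{Z}^N$-periodic functions on $\mathbf{R}^N$ (so $H(x/\varepsilon,p)$ makes sense for $x\in\mathbf{R}^N$). $\mathrm{Lip}(\mathbf{T}^N)$ is the set of Lipschitz continuous functions on $\mathbf{T}^N$. $D$ denotes the gradient in $x$. $\overline{B(x,r)}$ is the closed ball of radius $r$ centered at $x$. Viscosity solutions of the Cauchy problems are understood in the usual sense; existence and uniqueness of the bounded continuous viscosity solutions $u^\varepsilon$ and $u$ are known. Viscosity solutions on $\mathbf{T}^N$: for continuous $F:\mathbf{T}^N\times\mathbf{R}^N\to\mathbf{R}$ and $u\in C(\mathbf{T}^N)$, let $D^+u(x)$ (resp. $D^-u(x)$) be the set of $D\phi(x)$ with $\phi\in C^1(\mathbf{T}^N)$ such that $u-\phi$ attains its maximum (resp. minimum) over $\mathbf{T}^N$ at $x$. $u$ is a subsolution (resp. supersolution) of $F(x,Du)=0$ in $\mathbf{T}^N$ if $F(\hat x,p)\le0$ for all $\hat x$ and $p\in D^+u(\hat x)$ (resp. $F(\hat x,p)\ge0$ for all $\hat x$ and $p\in D^-u(\hat x)$); it is a solution if it is both. The equation $G(x,Du+P)=a$ is understood with $F(x,p)=G(x,p+P)-a$. The solvability set $\mathcal{D}$ is the set of $P\in\mathbf{R}^N$ for which there exists a pair $(v,a)\in\mathrm{Lip}(\mathbf{T}^N)\times\mathbf{R}$ such that $v$ is a viscosity solution of $H(x,Dv(x)+P)=a$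 in $\mathbf{T}^N$. Generalized effective Hamiltonian: consider sequences of functions $H_n:\mathbf{T}^N\times\mathbf{R}^N\to\mathbf{R}$ such that (A1) each $H_n$ is continuous; (A2) each $H_n$ is coercive: $\lim_{r\to\infty}\inf\{H_n(x,p)\mid x\in\mathbf{T}^N,\ |p|\ge r\}=+\infty$; (A3) $\liminf_{n\to\infty}\inf_{\mathbf{T}^N\times\overline{B(0,R)}}(H-H_n)\ge0$ for all $R>0$; (A4) $\limsup_{n\to\infty}\sup_{\mathbf{T}^N\times\mathbf{R}^N}(H-H_n)\le0$. For coercive continuous $H_n$ and each $P\in\mathbf{R}^N$ there is a unique constant $\bar{H}_n(P)$ (the effective Hamiltonian of $H_n$ at $P$) for which $H_n(x,Du_n+P)=\bar{H}_n(P)$ in $\mathbf{T}^N$ has a viscosity solution $u_n\in\mathrm{Lip}(\mathbf{T}^N)$. The generalized effective Hamiltonian $\bar{H}_\infty:\mathbf{R}^N\to\mathbf{R}$ of $H$ is the unique function such that for every sequence $\{H_n\}$ satisfying (A1)--(A4) one has $\liminf_{n\to\infty}\inf_{\overline{B(0,R)}}(\bar{H}_\infty-\bar{H}_n)\ge0$ for all $R>0$ and $\limsup_{n\to\infty}\sup_{\mathbf{R}^N}(\bar{H}_\infty-\bar{H}_n)\le0$; in particular $\bar{H}_\infty(P)=\lim_{n\to\infty}\bar{H}_n(P)$ for every $P$ and every such sequence. *)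

(* Defs.v *)
From HB Require Import structures.
From mathcomp Require Import all_boot all_order all_algebra.
From mathcomp Require Import all_classical all_reals all_analysis.

Set Implicit Arguments.
Unset Strict Implicit.
Unset Printing Implicit Defensive.

Import Order.TTheory GRing.Theory Num.Theory.
Import numFieldNormedType.Exports.

Local Open Scope classical_set_scope.
Local Open Scope ring_scope.

(* The library norm of 'rV[R]_N is the sup norm; |p| is the Euclidean one.    *)
Definition enorm (R : realType) (N : nat) (p : 'rV[R]_N) : R :=
  Num.sqrt (\sum_(i < N) (p 0 i) ^+ 2).

Definition elipschitz (R : realType) (N : nat) (f : 'rV[R]_N -> R) : Prop :=
  exists L : R, forall x y, `|f x - f y| <= L * enorm (x - y).

(* Lip[f], the best Lipschitz constant; meaningful when f is Lipschitz.       *)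
Definition lip_const (R : realType) (N : nat) (f : 'rV[R]_N -> R) : R :=
  sup [set `|f z.1 - f z.2| / enorm (z.1 - z.2) |
        z in [set z : 'rV[R]_N * 'rV[R]_N | z.1 != z.2]].

(* Functions on the torus R^N / Z^N are Z^N-periodic functions on R^N.        *)
Definition torus_periodic (R : realType) (N : nat) (T : Type)
    (f : 'rV[R]_N -> T) : Prop :=
  forall (x : 'rV[R]_N) (k : 'rV[int]_N),
    f (x + map_mx (fun z : int => z%:~R) k) = f x.

(* The value of a partial derivative is junk where it does not exist, so      *)
(* grad is only used together with a differentiability hypothesis.            *)
Definition grad (R : realType) (N : nat) (f : 'rV[R]_N -> R) (x : 'rV[R]_N)
    : 'rV[R]_N :=
  \row_(i < N) 'D_(delta_mx 0 i) f x.

Definition C1_torus (R : realType) (N : nat) (phi : 'rV[R]_N -> R) : Prop :=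
  [/\ torus_periodic phi,
      forall x, differentiable phi x
    & continuous (grad phi)].

Definition superdiff (R : realType) (N : nat) (u : 'rV[R]_N -> R)
    (x : 'rV[R]_N) : set 'rV[R]_N :=
  [set p | exists phi, [/\ C1_torus phi,
     forall y, u y - phi y <= u x - phi x & p = grad phi x]].

Definition subdiff (R : realType) (N : nat) (u : 'rV[R]_N -> R)
    (x : 'rV[R]_N) : set 'rV[R]_N :=
  [set p | exists phi, [/\ C1_torus phi,
     forall y, u x - phi x <= u y - phi y & p = grad phi x]].

Definition torus_subsolution (R : realType) (N : nat)
    (F : 'rV[R]_N -> 'rV[R]_N -> R) (u : 'rV[R]_N -> R) : Prop :=
  forall x p, superdiff u x p -> F x p <= 0.

Definition torus_supersolution (R : realType) (N : nat)
    (F : 'rV[R]_N -> 'rV[R]_N -> R) (u : 'rV[R]_N -> R) : Prop :=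
  forall x p, subdiff u x p -> 0 <= F x p.

Definition torus_solution (R : realType) (N : nat)
    (F : 'rV[R]_N -> 'rV[R]_N -> R) (u : 'rV[R]_N -> R) : Prop :=
  torus_subsolution F u /\ torus_supersolution F u.

(* v in Lip(T^N) is a viscosity solution of G(x, Dv + P) = a in T^N.          *)
Definition cell_solution (R : realType) (N : nat)
    (G : 'rV[R]_N -> 'rV[R]_N -> R) (P : 'rV[R]_N) (a : R)
    (v : 'rV[R]_N -> R) : Prop :=
  [/\ torus_periodic v,
      elipschitz v
    & torus_solution (fun x p => G x (p + P) - a) v].

Definition solvability_set (R : realType) (N : nat)
    (G : 'rV[R]_N -> 'rV[R]_N -> R) : set 'rV[R]_N :=
  [set P | exists (v : 'rV[R]_N -> R) (a : R), cell_solution G P a v].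

(* For periodic, continuous and coercive G such a constant a exists and is    *)
(* unique for each P; otherwise the value is conventional.                    *)
Definition effective_hamiltonian (R : realType) (N : nat)
    (G : 'rV[R]_N -> 'rV[R]_N -> R) (P : 'rV[R]_N) : R :=
  xget 0 [set a : R | exists v, cell_solution G P a v].

Definition torus_hamiltonian (R : realType) (N : nat)
    (G : 'rV[R]_N -> 'rV[R]_N -> R) : Prop :=
  (forall p, torus_periodic (G ^~ p)) /\
  continuous (fun z : 'rV[R]_N * 'rV[R]_N => G z.1 z.2).

Definition coercive (R : realType) (N : nat)
    (G : 'rV[R]_N -> 'rV[R]_N -> R) : Prop :=
  (fun r : R => ereal_inf [set (G z.1 z.2)%:E |
     z in [set z : 'rV[R]_N * 'rV[R]_N | r <= enorm z.2]])
    @ +oo --> +oo%E.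

(* Continuous coercive Hn such that liminf inf (H - Hn) >= 0 on bounded sets  *)
(* of p and limsup sup (H - Hn) <= 0 globally; limits in \bar R.              *)
Definition approximating_sequence (R : realType) (N : nat)
    (H : 'rV[R]_N -> 'rV[R]_N -> R)
    (Hn : nat -> 'rV[R]_N -> 'rV[R]_N -> R) : Prop :=
  [/\ forall n, torus_hamiltonian (Hn n),
      forall n, coercive (Hn n),
      forall r : R, 0 < r ->
        (0 <= limn_einf (fun n => ereal_inf
          [set (H z.1 z.2 - Hn n z.1 z.2)%:E |
            z in [set z : 'rV[R]_N * 'rV[R]_N | (enorm z.2 <= r)%R]]))%E
    & (limn_esup (fun n => ereal_sup
          [set (H z.1 z.2 - Hn n z.1 z.2)%:E |
            z in [set: 'rV[R]_N * 'rV[R]_N]]) <= 0)%E].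

Definition generalized_effective_hamiltonian (R : realType) (N : nat)
    (H : 'rV[R]_N -> 'rV[R]_N -> R) (Hinf : 'rV[R]_N -> R) : Prop :=
  forall Hn : nat -> 'rV[R]_N -> 'rV[R]_N -> R,
    approximating_sequence H Hn ->
    (forall r : R, 0 < r ->
      (0 <= limn_einf (fun n => ereal_inf
        [set (Hinf P - effective_hamiltonian (Hn n) P)%:E |
          P in [set P : 'rV[R]_N | (enorm P <= r)%R]]))%E) /\
    (limn_esup (fun n => ereal_sup
        [set (Hinf P - effective_hamiltonian (Hn n) P)%:E |
          P in [set: 'rV[R]_N]]) <= 0)%E.

(* Space-time points are pairs z = (x, t).                                    *)
Definition dx (R : realType) (N : nat) (phi : 'rV[R]_N * R -> R)
    (z : 'rV[R]_N * R) : 'rV[R]_N :=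
  grad (fun x => phi (x, z.2)) z.1.

Definition dt (R : realType) (N : nat) (phi : 'rV[R]_N * R -> R)
    (z : 'rV[R]_N * R) : R :=
  derive1 (fun s : R => phi (z.1, s)) z.2.

Definition open_strip (R : realType) (N : nat) (T : R) : set ('rV[R]_N * R) :=
  [set z | 0 < z.2 < T].

Definition strip (R : realType) (N : nat) (T : R) : set ('rV[R]_N * R) :=
  [set z | 0 <= z.2 < T].

Definition C1_strip (R : realType) (N : nat) (T : R)
    (phi : 'rV[R]_N * R -> R) : Prop :=
  forall z, open_strip T z ->
    [/\ differentiable phi z, {for z, continuous (dx phi)}
      & {for z, continuous (dt phi)}].

(* Viscosity sub- and supersolutions of u_t + F(x, Du) = 0 in R^N x (0,T),    *)
(* with test functions touching locally.                                      *)
Definition cauchy_subsolution (R : realType) (N : nat) (T : R)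
    (F : 'rV[R]_N -> 'rV[R]_N -> R) (u : 'rV[R]_N * R -> R) : Prop :=
  forall (phi : 'rV[R]_N * R -> R) (z : 'rV[R]_N * R),
    C1_strip T phi -> open_strip T z ->
    (\forall w \near z, u w - phi w <= u z - phi z) ->
    dt phi z + F z.1 (dx phi z) <= 0.

Definition cauchy_supersolution (R : realType) (N : nat) (T : R)
    (F : 'rV[R]_N -> 'rV[R]_N -> R) (u : 'rV[R]_N * R -> R) : Prop :=
  forall (phi : 'rV[R]_N * R -> R) (z : 'rV[R]_N * R),
    C1_strip T phi -> open_strip T z ->
    (\forall w \near z, u z - phi z <= u w - phi w) ->
    0 <= dt phi z + F z.1 (dx phi z).

(* u is a bounded viscosity solution, in C(R^N x [0,T)), of                   *)
(*   u_t + F(x, Du) = 0 in R^N x (0,T),   u(., 0) = u0.                       *)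
(* Values of u outside R^N x [0,T) are irrelevant.                            *)
Definition bounded_cauchy_solution (R : realType) (N : nat) (T : R)
    (F : 'rV[R]_N -> 'rV[R]_N -> R) (u0 : 'rV[R]_N -> R)
    (u : 'rV[R]_N * R -> R) : Prop :=
  [/\ {within strip T, continuous u},
      [bounded u z | z in strip T],
      cauchy_subsolution T F u,
      cauchy_supersolution T F u
    & forall x, u (x, 0) = u0 x].

(* Main.v *)
(* Call v an e-corrector at P if it is periodic and H(x, Dv + P) lies within e of
   Hinf(P) in the viscosity sense.  A solvable P has e-correctors for every e.  So has
   every P with smax m(|P|) < smin: Perron's method solves lam v + H(x, Dv + P) = 0
   with a Lipschitz bound independent of lam, and adding lam (v - v 0) to a coercive
   modification of H makes v an exact cell solution for an admissible approximating
   sequence, so that -lam (v 0) tends to Hinf(P) as lam -> 0; no compactness argument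
   is needed.  Either alternative of the theorem thus provides e-correctors for all
   |P| <= L1, for some L1 > Lip[u0].

   Doubling variables in u^eps(x, t) - u(y, s) with the penalty
   L' sqrt(|x - y|^2 + eta^2), where Lip[u0] < L' < L1, only produces slopes P with
   |P| <= L' up to small errors.  Freezing P at a maximum point and inserting
   eps v(x / eps), with v a corrector at P, bounds u^eps - u from above.  The lower
   bound follows by applying this to -u^eps, -u and -H(x, -p). *)

Require Import Defs.
From HB Require Import structures.
From mathcomp Require Import all_boot all_order all_algebra.
From mathcomp Require Import all_classical all_reals all_analysis.
From mathcomp Require Import ring lra.
Set Implicit Arguments.
Unset Strict Implicit.
Unset Printing Implicit Defensive.
Import Order.TTheory GRing.Theory Num.Theory.
Import numFieldNormedType.Exports.
Local Open Scope classical_set_scope.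
Local Open Scope ring_scope.

Lemma continuousP_dist (R : realType) (V W : normedModType R) (f : V -> W) :
  (forall x e, 0 < e ->
     exists2 d, 0 < d & forall y, `|x - y| < d -> `|f x - f y| < e) <->
  continuous f.
Proof.
split=> [fP x|cf x e e0].
  apply/cvgrPdist_lt => e e0; have [d d0 xd] := fP x e e0.
  by apply/nbhs_ballP; exists d => //= y; rewrite -ball_normE; exact: xd.
have /cvgrPdist_lt/(_ _ e0)/nbhs_ballP[d d0 xd] := cf x.
by exists d => // y xy; apply: xd; rewrite -ball_normE.
Qed.

(* Pointwise forms of the library combinators, stated globally so that the
   function arguments are found by higher-order pattern unification. *)
Section Continuity.
Context (R : realType) (T : topologicalType).
Implicit Types (f g : T -> R).

Lemma continuous_add f g : continuous f -> continuous g -> continuous (fun x => f x + g x).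
Proof. by move=> cf cg x; exact: (cvgD (cf x) (cg x)). Qed.

Lemma continuous_sub f g : continuous f -> continuous g -> continuous (fun x => f x - g x).
Proof. by move=> cf cg x; exact: (cvgB (cf x) (cg x)). Qed.

Lemma continuous_mul f g : continuous f -> continuous g -> continuous (fun x => f x * g x).
Proof. by move=> cf cg x; exact: (cvgM (cf x) (cg x)). Qed.

Lemma continuous_const (U : topologicalType) (c : U) : continuous (fun _ : T => c).
Proof. by move=> x; exact: cvg_cst. Qed.

Lemma continuous_compose (U W : topologicalType) (g : U -> W) (f : T -> U) :
  continuous g -> continuous f -> continuous (fun x => g (f x)).
Proof. by move=> cg cf x; exact: (cvg_comp _ _ (cf x) (cg (f x))). Qed.

Lemma continuous_vsub (V : normedModType R) (f g : T -> V) :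
  continuous f -> continuous g -> continuous (fun x => f x - g x).
Proof. by move=> cf cg x; exact: (cvgB (cf x) (cg x)). Qed.

Lemma continuous_vadd (V : normedModType R) (f g : T -> V) :
  continuous f -> continuous g -> continuous (fun x => f x + g x).
Proof. by move=> cf cg x; exact: (cvgD (cf x) (cg x)). Qed.

Lemma continuous_vopp (V : normedModType R) (f : T -> V) :
  continuous f -> continuous (fun x => - f x).
Proof. by move=> cf x; apply: cvgN; exact: cf. Qed.

Lemma continuous_scale (V : normedModType R) (c : R) (f : T -> V) :
  continuous f -> continuous (fun x => c *: f x).
Proof. by move=> cf x; apply: cvgZl_tmp; exact: cf. Qed.

Lemma continuous_abs f : continuous f -> continuous (fun x => `|f x|).
Proof. by move=> cf x; exact: (cvg_norm (cf x)). Qed.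

End Continuity.

Lemma continuous_fst (T U : topologicalType) : continuous (@fst T U).
Proof. by move=> x; exact: cvg_fst. Qed.

Lemma continuous_snd (T U : topologicalType) : continuous (@snd T U).
Proof. by move=> x; exact: cvg_snd. Qed.

Lemma continuous_ident (T : topologicalType) : continuous (fun x : T => x).
Proof. by move=> x; exact: cvg_id. Qed.

Section OneVariable.
Context (R : realType).
Implicit Types (t a b : R).

Lemma is_derive_affine a b t : is_derive t 1 (fun s => a * s + b) a.
Proof.
apply: (@is_derive_eq _ _ _ ((a \*: (id : R -> R^o)) + cst b)).
by rewrite /GRing.scale/= mulr1 addr0.
Qed.

Lemma is_derive_sqr (f : R -> R) t df : is_derive t 1 f df ->
  is_derive t 1 (fun s => f s ^+ 2) (2 * f t * df).
Proof.
move=> fd; apply: (@is_derive_eq _ _ _ (f ^+ 2)).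
by rewrite /= expr1.
Qed.

Lemma is_derive_sin_sqr a b t : is_derive t 1 (fun s => sin (a * s + b) ^+ 2)
   (2 * sin (a * t + b) * (cos (a * t + b) * a)).
Proof.
apply: is_derive_sqr; apply: is_derive1_comp; exact: is_derive_affine.
Qed.
End OneVariable.

(** * Euclidean norm and gradients *)

Section EuclideanNorm.
Context (R : realType) (N : nat).
Implicit Types (p q : 'rV[R]_N) (c : R).

Definition dotv p q : R := \sum_(i < N) p 0 i * q 0 i.

Lemma enorm_ge0 p : 0 <= enorm p.
Proof. exact: sqrtr_ge0. Qed.

Lemma sqr_enorm p : enorm p ^+ 2 = \sum_(i < N) p 0 i ^+ 2.
Proof. by rewrite sqr_sqrtr// sumr_ge0// => i _; rewrite sqr_ge0. Qed.

Lemma dotvv p : dotv p p = enorm p ^+ 2.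
Proof. by rewrite sqr_enorm; apply: eq_bigr => i _; rewrite expr2. Qed.

Lemma enormZ c p : enorm (c *: p) = `|c| * enorm p.
Proof.
rewrite /enorm -sqrtr_sqr -sqrtrM ?sqr_ge0// mulr_sumr.
by congr Num.sqrt; apply: eq_bigr => i _; rewrite mxE exprMn.
Qed.

Lemma enormN p : enorm (- p) = enorm p.
Proof. by rewrite -scaleN1r enormZ normrN normr1 mul1r. Qed.

Lemma enormBC p q : enorm (p - q) = enorm (q - p).
Proof. by rewrite -enormN opprB. Qed.

Lemma enorm0 : enorm (0 : 'rV[R]_N) = 0.
Proof. by rewrite -(scale0r 0) enormZ normr0 mul0r. Qed.

Lemma coord_le_enorm p i : `|p 0 i| <= enorm p.
Proof.
rewrite -sqrtr_sqr ler_sqrt ?sumr_ge0//; last by move=> *; rewrite sqr_ge0.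
by rewrite (bigD1 i)//= lerDl sumr_ge0// => j _; rewrite sqr_ge0.
Qed.

Lemma enorm_eq0 p : (enorm p == 0) = (p == 0).
Proof.
apply/eqP/eqP => [p0|->]; last exact: enorm0.
apply/rowP => i; rewrite mxE; apply/eqP; rewrite -normr_le0 -p0.
exact: coord_le_enorm.
Qed.

Lemma norm_le_enorm p : `|p| <= enorm p.
Proof.
rewrite [leLHS]/Num.norm /= mx_normrE; apply/bigmax_leP.
by split=> [|[i j] _]; [exact: enorm_ge0|rewrite ord1 coord_le_enorm].
Qed.

Lemma coord_le_norm p i : `|p 0 i| <= `|p|.
Proof.
by rewrite [leRHS]/Num.norm /= mx_normrE; apply/bigmax_geP; right => /=; exists (0, i).
Qed.

Lemma enorm_le_norm p : enorm p <= Num.sqrt N%:R * `|p|.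
Proof.
rewrite -[X in _ * X]ger0_norm// -sqrtr_sqr -sqrtrM ?ler0n//.
rewrite ler_wsqrtr// mulr_natl -[X in _ *+ X]card_ord -sumr_const.
apply: ler_sum => i _; rewrite -[leLHS]real_normK ?num_real//.
by rewrite lerXn2r ?nnegrE// coord_le_norm.
Qed.

Lemma dotv_le p q : dotv p q <= enorm p * enorm q.
Proof.
have [/eqP|p0] := eqVneq (enorm p) 0.
  rewrite enorm_eq0 => /eqP ->; rewrite enorm0 mul0r.
  by rewrite /dotv big1// => i _; rewrite mxE mul0r.
have [/eqP|q0] := eqVneq (enorm q) 0.
  rewrite enorm_eq0 => /eqP ->; rewrite enorm0 mulr0.
  by rewrite /dotv big1// => i _; rewrite mxE mulr0.
have a0 : 0 < enorm p by rewrite lt_def p0 enorm_ge0.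
have b0 : 0 < enorm q by rewrite lt_def q0 enorm_ge0.
have ab0 : 0 < enorm p * enorm q by rewrite mulr_gt0.
have : 0 <= \sum_(i < N) (enorm q * p 0 i - enorm p * q 0 i) ^+ 2.
  by apply: sumr_ge0 => i _; rewrite sqr_ge0.
have -> : \sum_(i < N) (enorm q * p 0 i - enorm p * q 0 i) ^+ 2 =
  enorm q ^+ 2 * \sum_(i < N) p 0 i ^+ 2 +
  enorm p ^+ 2 * \sum_(i < N) q 0 i ^+ 2 - 2 * (enorm p * enorm q) * dotv p q.
  rewrite /dotv !mulr_sumr -big_split -sumrB/=.
  by apply: eq_bigr => i _; ring.
rewrite -!sqr_enorm => h; rewrite -(ler_pM2l ab0); move: h; nra.
Qed.

Lemma enormD p q : enorm (p + q) <= enorm p + enorm q.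
Proof.
rewrite -(@ler_pXn2r _ 2%N)// ?nnegrE ?addr_ge0 ?enorm_ge0//.
have -> : enorm (p + q) ^+ 2 = enorm p ^+ 2 + enorm q ^+ 2 + 2 * dotv p q.
  rewrite !sqr_enorm /dotv mulr_sumr -!big_split/=.
  by apply: eq_bigr => i _; rewrite mxE; ring.
by rewrite sqrrD; have := dotv_le p q; nra.
Qed.

Lemma enormB p q : enorm (p - q) <= enorm p + enorm q.
Proof. by rewrite -[enorm q]enormN enormD. Qed.

Lemma enorm_lipschitz p q : `|enorm p - enorm q| <= enorm (p - q).
Proof.
rewrite ler_norml; apply/andP; split.
  by have := enormD (q - p) p; rewrite subrK [enorm (q - p)]enormBC; lra.
by have := enormD (p - q) q; rewrite subrK; lra.
Qed.

Lemma enorm_lipschitz_continuous (f : 'rV[R]_N -> R) C :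
  (forall x y, `|f x - f y| <= C * enorm (x - y)) -> continuous f.
Proof.
move=> fC; apply/continuousP_dist => x e e0.
pose D := `|C| * Num.sqrt N%:R + 1.
have D0 : 0 < D by rewrite ltr_wpDl// mulr_ge0// sqrtr_ge0.
exists (e / D) => [|y xy]; first by rewrite divr_gt0.
apply: le_lt_trans (fC x y) _.
apply: (@le_lt_trans _ _ (D * `|x - y|)); last by rewrite mulrC -ltr_pdivlMr.
apply: (@le_trans _ _ (`|C| * (Num.sqrt N%:R * `|x - y|))).
  apply: le_trans (ler_wpM2r (enorm_ge0 _) (ler_norm C)) _.
  by rewrite ler_wpM2l// enorm_le_norm.
by rewrite mulrA ler_wpM2r// lerDl.
Qed.

Lemma continuous_enorm : continuous (@enorm R N).
Proof.
apply: (@enorm_lipschitz_continuous _ 1) => x y.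
by rewrite mul1r enorm_lipschitz.
Qed.

Lemma dotvDl p p' q : dotv (p + p') q = dotv p q + dotv p' q.
Proof. by rewrite /dotv -big_split; apply: eq_bigr => i _; rewrite mxE mulrDl. Qed.

Lemma dotvZl c p q : dotv (c *: p) q = c * dotv p q.
Proof. by rewrite /dotv mulr_sumr; apply: eq_bigr => i _; rewrite mxE mulrA. Qed.

Lemma dotvNl p q : dotv (- p) q = - dotv p q.
Proof. by rewrite -scaleN1r dotvZl mulN1r. Qed.

Lemma dotvZr c p q : dotv p (c *: q) = c * dotv p q.
Proof. by rewrite /dotv mulr_sumr; apply: eq_bigr => i _; rewrite mxE mulrCA. Qed.

Lemma dotv_delta p i : dotv p (delta_mx 0 i) = p 0 i.
Proof.
rewrite /dotv (bigD1 i)//= mxE !eqxx mulr1 big1 ?addr0// => j ji.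
by rewrite mxE eqxx (negbTE ji) mulr0.
Qed.

End EuclideanNorm.

Section Gradient.
Context (R : realType) (N : nat).
Local Notation V := 'rV[R]_N.
Implicit Types (f : V -> R) (g : V -> V).

Definition has_grad f g := forall x : V, is_diff x f (dotv (g x)).

Lemma has_grad_differentiable f g x : has_grad f g -> differentiable f x.
Proof. by move=> /(_ x) fg; exact: ex_diff. Qed.

Lemma has_grad_derive f g x v : has_grad f g -> 'D_v f x = dotv (g x) v.
Proof.
move=> /(_ x) fg; rewrite deriveE; last exact: ex_diff.
by rewrite (@diff_val _ _ _ _ _ _ _ fg).
Qed.

Lemma grad_has_grad f g : has_grad f g -> grad f = g.
Proof.
move=> fg; apply/funext => x; apply/rowP => i.
by rewrite mxE (has_grad_derive _ _ fg) dotv_delta.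
Qed.

Lemma has_gradP f : (forall x, differentiable f x) -> has_grad f (grad f).
Proof.
move=> df x; apply: DiffDef => //.
apply/funext => v; rewrite [in LHS](row_sum_delta v) linear_sum /dotv.
apply: eq_bigr => i _; rewrite linearZ/= mxE mulrC; congr (_ * _).
by rewrite deriveE.
Qed.

Lemma eq_has_grad f f' g g' : (forall x, f x = f' x) -> (forall x, g x = g' x) ->
  has_grad f g -> has_grad f' g'.
Proof. by move=> /funext -> /funext ->. Qed.

Lemma has_gradD f f' g g' : has_grad f g -> has_grad f' g' ->
  has_grad (fun x => f x + f' x) (fun x => g x + g' x).
Proof.
move=> fg fg' x; have h := fg x; have h' := fg' x.
apply: is_diff_eq.
by apply/funext => v /=; rewrite dotvDl.
Qed.

Lemma has_gradZ c f g : has_grad f g -> has_grad (fun x => c * f x) (fun x => c *: g x).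
Proof.
move=> fg x; have h := fg x.
apply: is_diff_eq.
by apply/funext => v /=; rewrite dotvZl.
Qed.

Lemma has_gradN f g : has_grad f g -> has_grad (fun x => - f x) (fun x => - g x).
Proof.
move=> fg; apply: (eq_has_grad _ _ (has_gradZ (-1) fg)) => x.
  by rewrite mulN1r.
by rewrite scaleN1r.
Qed.

Lemma has_grad_cst c : has_grad (fun=> c) (fun=> 0).
Proof.
move=> x; apply: (@is_diff_eq _ _ _ (cst c) 0).
by apply/funext => v /=; rewrite /dotv big1// => i _; rewrite mxE mul0r.
Qed.

Lemma has_grad_comp f g (h h' : R -> R) :
  (forall x, is_derive (f x) 1 h (h' (f x))) -> has_grad f g ->
  has_grad (fun x => h (f x)) (fun x => h' (f x) *: g x).
Proof.
move=> hh' fg x; have dfx := fg x.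
have dh : is_diff (f x) h (fun r => r *: h' (f x)).
  apply: DiffDef; first exact/derivable1_diffP/ex_derive.
  rewrite diff1E; last exact/derivable1_diffP/ex_derive.
  by rewrite derive1E derive_val.
apply: (@is_diff_eq _ _ _ (h \o f) ((fun r => r *: h' (f x)) \o dotv (g x))).
by apply/funext => v /=; rewrite dotvZl mulrC.
Qed.

Lemma has_grad_coord i : has_grad (fun x => x 0 i) (fun=> delta_mx 0 i).
Proof.
move=> x; have -> : dotv (delta_mx 0 i) = (fun v : V => v 0 i).
  apply/funext => v; rewrite /dotv (bigD1 i)//= mxE !eqxx mul1r big1 ?addr0// => j ji.
  by rewrite mxE eqxx (negbTE ji) mul0r.
apply: DiffDef; first exact: differentiable_coord.
have lin : linear (fun v : V => v 0 i : R^o) by move=> a u v; rewrite !mxE.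
pose L := GRing.isLinear.Build _ _ _ _ (fun v : V => v 0 i : R^o) lin.
pose l : {linear V -> R^o} := HB.pack (fun v : V => v 0 i : R^o) L.
by have := @diff_lin _ _ _ l x (@coord_continuous _ _ _ _ _).
Qed.

Lemma has_grad_sum (I : Type) (r : seq I) (F : I -> V -> R) (G : I -> V -> V) :
  (forall i, has_grad (F i) (G i)) ->
  has_grad (fun x => \sum_(i <- r) F i x) (fun x => \sum_(i <- r) G i x).
Proof.
move=> FG; elim: r => [|i r IH].
  by apply: (eq_has_grad _ _ (has_grad_cst 0)) => x; rewrite big_nil.
by apply: (eq_has_grad _ _ (has_gradD (FG i) IH)) => x; rewrite big_cons.
Qed.

Lemma has_grad_sum_coord (h h' : 'I_N -> R -> R) :
  (forall i (t : R), is_derive t 1 (h i) (h' i t)) ->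
  has_grad (fun x => \sum_(i < N) h i (x 0 i)) (fun x => \row_i h' i (x 0 i)).
Proof.
move=> hh'.
have -> : (fun x : V => \row_i h' i (x 0 i)) =
    (fun x => \sum_(i < N) h' i (x 0 i) *: delta_mx 0 i).
  by apply/funext => x; rewrite [LHS]row_sum_delta; apply: eq_bigr => i _; rewrite mxE.
apply: has_grad_sum => i.
apply: (@has_grad_comp (fun x => x 0 i) _ (h i) (h' i)) => // x.
exact: has_grad_coord.
Qed.

Lemma continuous_row (T : topologicalType) (g : T -> V) :
  (forall i, continuous (fun x => g x 0 i)) -> continuous g.
Proof.
move=> gi x; apply/cvgrPdist_lt => e e0; near=> y.
have lt : forall i, `|g x 0 i - g y 0 i| < e.
  near: y; apply: filter_forall => i.
  by have /cvgrPdist_lt/(_ _ e0) := gi i x.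
rewrite /Num.norm /= mx_normrE; apply/bigmax_ltP; split=> // -[i j] _ /=.
by rewrite ord1 !mxE lt.
Unshelve. all: by end_near. Qed.

Lemma has_grad_continuous f g : has_grad f g -> continuous f.
Proof. by move=> fg x; apply: differentiable_continuous; exact: has_grad_differentiable fg. Qed.

End Gradient.

(** * Doubling of variables on the torus *)

Section Torus.
Context (R : realType) (N : nat).
Local Notation V := 'rV[R]_N.
Implicit Types (x y a : V) (k : 'rV[int]_N) (f : V -> R).

Definition psi x : R := \sum_(i < N) sin (pi * x 0 i) ^+ 2.
Definition dpsi x : V := \row_i (2 * pi * sin (pi * x 0 i) * cos (pi * x 0 i)).
Local Notation intv k := (map_mx (fun z : int => z%:~R : R) k).

Lemma psi_ge0 x : 0 <= psi x.
Proof. by apply: sumr_ge0 => i _; rewrite sqr_ge0. Qed.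

Lemma psi0 : psi 0 = 0.
Proof. by rewrite /psi big1// => i _; rewrite mxE mulr0 sin0 expr0n. Qed.

Lemma psiN x : psi (- x) = psi x.
Proof. by apply: eq_bigr => i _; rewrite mxE mulrN sinN sqrrN. Qed.

Lemma dpsiN x : dpsi (- x) = - dpsi x.
Proof. by apply/rowP => i; rewrite !mxE mulrN sinN cosN mulrN mulNr. Qed.

Lemma sin_piD_int (t : R) (z : int) : sin (pi * (t + z%:~R)) ^+ 2 = sin (pi * t) ^+ 2.
Proof.
have nat_case n (u : R) : sin (pi * (u + n%:R)) ^+ 2 = sin (pi * u) ^+ 2.
  elim: n u => [|n IH] u; first by rewrite addr0.
  by rewrite -natr1 addrA mulrDr mulr1 sinDpi sqrrN IH.
case: z => n; first exact: nat_case.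
by rewrite NegzE mulrNz -[in RHS](subrK n.+1%:R t) nat_case.
Qed.

Lemma psi_periodic x k : psi (x + intv k) = psi x.
Proof. by apply: eq_bigr => i _; rewrite !mxE sin_piD_int. Qed.

Lemma has_grad_psi c a :
  has_grad (fun x => psi (c *: x - a)) (fun x => c *: dpsi (c *: x - a)).
Proof.
apply: (eq_has_grad _ _ (has_grad_sum_coord
    (fun i t => is_derive_sin_sqr (pi * c) (- (pi * a 0 i)) t))) => x.
  by apply: eq_bigr => i _; rewrite !mxE mulrBr mulrA.
apply/rowP => i; rewrite !mxE.
have -> : pi * (c * x 0 i - a 0 i) = pi * c * x 0 i - pi * a 0 i by ring.
by ring.
Qed.

Lemma continuous_dpsi : continuous dpsi.
Proof.
apply: continuous_row => i.
rewrite (_ : (fun y => dpsi y 0 i) = (fun y : V =>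
  2 * pi * sin (pi * y 0 i) * cos (pi * y 0 i))); last by apply/funext => y; rewrite mxE.
have cp : continuous (fun y : V => pi * y 0 i).
  by refine (continuous_mul _ _); [exact: continuous_const|exact: coord_continuous].
refine (continuous_mul _ _); first refine (continuous_mul _ _).
- exact: continuous_const.
- by refine (continuous_compose (@continuous_sin R) cp).
- by refine (continuous_compose (@continuous_cos R) cp).
Qed.

Lemma continuous_psi : continuous psi.
Proof.
have := has_grad_continuous (has_grad_psi 1 0).
by under eq_fun do rewrite scale1r subr0.
Qed.

Lemma continuous_psi_sub : continuous (fun z : V * V => psi (z.1 - z.2)).
Proof.
refine (continuous_compose (continuous_psi) _).
by refine (continuous_vsub _ _); [exact: continuous_fst|exact: continuous_snd].
Qed.

Lemma psi_eq0 x : psi x = 0 -> exists k, x = intv k.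
Proof.
move=> /eqP; rewrite psumr_eq0; last by move=> i _; rewrite sqr_ge0.
move=> /allP h; exists (\row_i Num.floor (x 0 i)); apply/rowP => i; rewrite !mxE.
have /= := h i (mem_index_enum _); rewrite sqrf_eq0.
rewrite -sqrf_eq0 -(sin_piD_int _ (- Num.floor (x 0 i))) sqrf_eq0 mulrNz => /eqP s0.
have /andP[f1 f2] := floor_itv (x 0 i).
apply/eqP; rewrite -subr_eq0; apply/negPn/negP => ne0.
have : 0 < sin (pi * (x 0 i - (Num.floor (x 0 i))%:~R)).
  apply: sin_gt0_pi; apply/andP; split.
    by rewrite mulr_gt0 ?pi_gt0// lt_def ne0 subr_ge0.
  rewrite -[ltRHS]mulr1 ltr_pM2l ?pi_gt0// ltrBlDr addrC.
  by move: f2; rewrite intrD.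
by rewrite s0 ltxx.
Qed.

Definition cube : set V := [set x | forall i, x 0 i \in `[0, 1]].

Lemma compact_cube : compact cube.
Proof.
have := @rV_compact R N (fun=> `[0, 1]%classic) (fun=> @segment_compact R 0 1).
by rewrite (_ : [set _ | _] = cube).
Qed.

Lemma cube0 : cube 0.
Proof. by move=> i; rewrite mxE in_itv/= lexx ler01. Qed.

Lemma to_cube x : exists k, cube (x + intv k).
Proof.
exists (\row_i (- Num.floor (x 0 i))) => i; rewrite !mxE mulrNz in_itv/=.
have /andP[f1 f2] := floor_itv (x 0 i).
rewrite subr_ge0 f1/= lerBlDl.
by move: f2; rewrite intrD => /ltW.
Qed.

Lemma torus_max2 (f : V * V -> R) : continuous f ->
  (forall x y k, f (x + intv k, y) = f (x, y)) ->
  (forall x y k, f (x, y + intv k) = f (x, y)) ->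
  exists x y, forall x' y', f (x', y') <= f (x, y).
Proof.
move=> cf f1 f2.
have [] := @compact_EVT_max _ R f (cube `*` cube).
- by exists (0, 0); split; exact: cube0.
- exact: compact_setX compact_cube compact_cube.
- exact: continuous_subspaceT.
move=> [x y] _ xy_max; exists x, y => x' y'.
have [k xk] := to_cube x'; have [l yl] := to_cube y'.
rewrite -(f1 x' y' k) -(f2 _ y' l); apply: xy_max.
by rewrite inE; split.
Qed.

Lemma torus_max f : continuous f -> torus_periodic f -> exists x, forall y, f y <= f x.
Proof.
move=> cf pf; have [] := @torus_max2 (fun z => f z.1).
- exact: (continuous_compose cf (@continuous_fst _ _)).
- by move=> x y k; exact: pf.
- by [].
by move=> x [y h]; exists x => z; exact: (h z 0).
Qed.

Lemma torus_bounded f : continuous f -> torus_periodic f -> exists B, forall x, `|f x| <= B.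
Proof.
move=> cf pf; have [] := @torus_max (fun x => `|f x|).
- exact: continuous_abs.
- by move=> x k /=; rewrite pf.
by move=> x xmax; exists `|f x|.
Qed.

(* [psi] separates the points of the torus, so a continuous function on the
   torus has a modulus of continuity measured by [psi]. *)
Lemma torus_modulus f eta : continuous f -> torus_periodic f -> 0 < eta ->
  exists2 d, 0 < d & forall x y, psi (x - y) <= d -> `|f x - f y| <= eta.
Proof.
move=> cf pf eta0.
pose A := (cube `*` cube) `&` [set z : V * V | eta <= `|f z.1 - f z.2|].
have cdiff : continuous (fun z : V * V => `|f z.1 - f z.2|).
  refine (continuous_abs _); refine (continuous_sub _ _).
    exact: (continuous_compose cf (@continuous_fst _ _)).
  exact: (continuous_compose cf (@continuous_snd _ _)).
have compA : compact A.
  apply: compact_closedI; first exact: compact_setX compact_cube compact_cube.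
  by move/continuous_closedP: cdiff => /(_ [set r : R | eta <= r]); apply; exact: closed_ge.
have [A0|/nonemptyPn A0] := pselect (A !=set0); last first.
  exists 1 => // x y _; rewrite leNgt; apply/negP => /ltW le.
  have [k xk] := to_cube x; have [l yl] := to_cube y.
  have : A (x + intv k, y + intv l) by split => //=; rewrite !pf.
  by rewrite A0.
have cpsi := continuous_psi_sub.
have [|[z1 z2] zA zmin] := compact_EVT_min A0 compA (f := fun z : V * V => psi (z.1 - z.2)).
  exact: continuous_subspaceT.
rewrite inE in zA; case: zA => _ zA.
have psiz : 0 < psi (z1 - z2).
  rewrite lt_def psi_ge0 andbT; apply/eqP => /psi_eq0[k /eqP].
  rewrite subr_eq addrC => /eqP zk; move: zA; rewrite /= zk pf subrr normr0.
  by rewrite leNgt eta0.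
exists (psi (z1 - z2) / 2) => [|x y le]; first by rewrite divr_gt0.
rewrite leNgt; apply/negP => /ltW ge.
have [k xk] := to_cube x; have [l yl] := to_cube y.
have : A (x + intv k, y + intv l) by split => //=; rewrite !pf.
move=> /mem_set/zmin/=.
rewrite (_ : x + intv k - (y + intv l) = (x - y + intv k) + intv (- l)).
  by rewrite !psi_periodic; move: le psiz; lra.
by apply/rowP => i; rewrite !mxE mulrNz; ring.
Qed.

Lemma C1_torus_has_grad f (g : V -> V) :
  torus_periodic f -> has_grad f g -> continuous g -> C1_torus f.
Proof.
move=> pf fg cg; split=> // [x|]; first exact: has_grad_differentiable fg.
by rewrite (grad_has_grad fg).
Qed.

Lemma C1_psi c a : C1_torus (fun x => c * psi (x - a)) /\
  grad (fun x => c * psi (x - a)) = (fun x => c *: dpsi (x - a)).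
Proof.
have hg : has_grad (fun x => c * psi (x - a)) (fun x => c *: dpsi (x - a)).
  by apply: (eq_has_grad _ _ (has_gradZ c (has_grad_psi 1 a))) => x; rewrite !scale1r.
split; last exact: grad_has_grad.
apply: (C1_torus_has_grad _ hg) => [x k|].
  by congr (_ * _); rewrite addrAC psi_periodic.
refine (continuous_scale _); refine (continuous_compose (continuous_dpsi) _).
by refine (continuous_vsub _ _); [exact: continuous_ident|exact: continuous_const].
Qed.

Definition torus_unif_cont (G : V -> V -> R) : Prop := forall eta, 0 < eta ->
  exists2 d, 0 < d & forall x y p, psi (x - y) <= d -> `|G x p - G y p| <= eta.

(* Test functions on the torus have to be periodic, so the variables are doubled with
   [psi] in place of the squared distance. *)
Lemma cell_comparison (G : V -> V -> R) (M : R) (v w : V -> R) (P Q : V) (a b : R) :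
  torus_unif_cont G -> (forall x p q, `|G x p - G x q| <= M * enorm (p - q)) ->
  continuous v -> torus_periodic v -> continuous w -> torus_periodic w ->
  torus_subsolution (fun x p => G x (p + P) - a) v ->
  torus_supersolution (fun x p => G x (p + Q) - b) w ->
  b <= a + M * enorm (P - Q).
Proof.
move=> Gx GM cv pv cw pw subv supw; apply/ler_addgt0Pr => eta eta0.
have [d d0 Gd] := Gx _ eta0.
have [B vB] := torus_bounded cv pv.
have B0 : 0 <= B by apply: le_trans (vB 0).
pose A := 2 * B / d.
have A0 : 0 <= A by rewrite divr_ge0// ?mulr_ge0// ltW.
have [] := @torus_max2 (fun z => v z.1 - w z.2 - (A + 1) * psi (z.1 - z.2)).
- refine (continuous_sub _ _); first refine (continuous_sub _ _).
  + exact: (continuous_compose cv (@continuous_fst _ _)).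
  + exact: (continuous_compose cw (@continuous_snd _ _)).
  by refine (continuous_mul _ _); [exact: continuous_const|exact: continuous_psi_sub].
- by move=> x y k /=; rewrite pv; congr (_ - _ * _); rewrite addrAC psi_periodic.
- move=> x y k /=; rewrite pw; congr (_ - _ * _).
  by rewrite -psiN -[RHS]psiN !opprB addrAC psi_periodic.
move=> x [y /= xymax].
have psid : psi (x - y) <= d.
  have := xymax y y; rewrite subrr psi0 => h.
  have h1 : (A + 1) * psi (x - y) <= (A + 1) * d.
    have : A * d = 2 * B by rewrite /A divfK// gt_eqF.
    by move: (vB x) (vB y) h; rewrite !ler_norml => /andP[? ?] /andP[? ?]; nra.
  by rewrite ler_pM2l in h1 => //; rewrite ltr_wpDl.
have /subv : superdiff v x ((A + 1) *: dpsi (x - y)).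
  have [c1 gr] := C1_psi (A + 1) y.
  exists (fun x => (A + 1) * psi (x - y)); split=> //; last by rewrite gr.
  by move=> z; have := xymax z y; lra.
have /supw : subdiff w y ((A + 1) *: dpsi (x - y)).
  have [c1 gr] := C1_psi (- (A + 1)) x.
  exists (fun y => - (A + 1) * psi (y - x)); split=> //.
    by move=> z; have := xymax x z; rewrite -(psiN (x - y)) -(psiN (x - z)) !opprB; lra.
  by rewrite gr -opprB dpsiN scalerN scaleNr.
set q := (A + 1) *: _ => supq subq.
have h1 := Gd x y (q + Q) psid.
have := GM x (q + P) (q + Q).
rewrite (_ : q + P - (q + Q) = P - Q); last by rewrite opprD addrACA subrr add0r.
by move: h1; rewrite !ler_norml => /andP[? ?] /andP[? ?]; lra.
Qed.

End Torus.

(** * Effective Hamiltonians *)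

Section EventualBounds.
Context (R : realType).
Implicit Types u : nat -> \bar R.
Local Open Scope ereal_scope.

Lemma limn_esup_le0P u :
  limn_esup u <= 0 <-> forall e : R, (0 < e)%R -> \forall n \near \oo, u n <= e%:E.
Proof.
split=> [u0 e e0|ue].
  have /ereal_inf_lt[_ [V ooV <-] Ve] : limn_esup u < e%:E.
    by apply: le_lt_trans u0 _; rewrite lte_fin.
  by apply: filterS ooV => n Vn; apply: le_trans (ltW Ve); apply: ereal_sup_ubound; exists n.
apply/lee_addgt0Pr => e /ue ooV; rewrite add0e.
apply: (@le_trans _ _ (ereal_sup (u @` [set n | u n <= e%:E]))).
  by apply: ereal_inf_lbound; exists [set n | u n <= e%:E].
by apply: ge_ereal_sup => _ [n /= un <-].
Qed.

Lemma limn_einf_ge0P u :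
  0 <= limn_einf u <-> forall e : R, (0 < e)%R -> \forall n \near \oo, (- e)%:E <= u n.
Proof.
rewrite /limn_einf leeNr oppe0; split=> [/limn_esup_le0P h e /h|h].
  by apply: filterS => n; rewrite leeNl EFinN.
by apply/limn_esup_le0P => e /h; apply: filterS => n; rewrite leeNl EFinN.
Qed.

End EventualBounds.

Section DirectionalDerivative.
Context (R : realType) (N : nat).
Local Notation V := 'rV[R]_N.

Lemma derive_lt_secant (f : V -> R) (x v : V) (c : R) :
  derivable f x v -> 'D_v f x < c ->
  exists2 e, 0 < e & forall h, 0 < h < e -> f (x + h *: v) < f x + h * c.
Proof.
move=> dfx Dc.
have cvgD : (fun h => h^-1 *: (f (h *: v + x) - f x)) @ 0^' --> 'D_v f x by exact: dfx.
have : nbhs (0 : R) (fun h : R => h != 0 -> h^-1 *: (f (h *: v + x) - f x) < c).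
  exact: (cvgr_lt _ cvgD _ Dc).
move=> /nbhs_ballP[e /= e0 He]; exists e => // h /andP[h0 he].
have := He h; rewrite /ball/= sub0r normrN gtr0_norm// => /(_ he).
rewrite gt_eqF// => /(_ isT); rewrite [h^-1 *: _]mulrC ltr_pdivrMr// => fh.
by rewrite [x + _]addrC; lra.
Qed.

Lemma derive_gt_secant (f : V -> R) (x v : V) (c : R) :
  derivable f x v -> c < 'D_v f x ->
  exists2 e, 0 < e & forall h, 0 < h < e -> f x + h * c < f (x + h *: v).
Proof.
move=> dfx Dc; have := @derive_lt_secant (fun y => - f y) x v (- c).
rewrite (_ : (fun y => - f y) = - f)// deriveN// ltrN2 => /(_ (derivableN dfx) Dc)[e e0 he].
exists e => // h /he; rewrite mulrN; lra.
Qed.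

Lemma superdiff_enorm_le (u : V -> R) (x p : V) (C : R) : 0 <= C ->
  (forall y z, `|u y - u z| <= C * enorm (y - z)) -> superdiff u x p -> enorm p <= C.
Proof.
move=> C0 uC [phi [[_ dphi _] umax pE]]; rewrite leNgt; apply/negP => Cp.
have p0 : 0 < enorm p by apply: le_lt_trans C0 Cp.
have hg := has_gradP dphi.
have Dp : 'D_(- p) phi x < - (C * enorm p).
  rewrite (has_grad_derive _ _ hg) -pE -[- p]scaleN1r dotvZr dotvv mulN1r ltrN2.
  by rewrite expr2 ltr_pM2r.
have dp : derivable phi x (- p) by exact: diff_derivable.
have [e e0 he] := derive_lt_secant dp Dp.
have /he : 0 < e / 2 < e by apply/andP; split; lra.
set y := x + _ => phiy.
have := umax y; have := uC y x.
rewrite (_ : y - x = (e / 2) *: (- p)); last by rewrite /y addrC addKr.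
rewrite enormZ enormN [`|e / 2|]gtr0_norm ?divr_gt0// ler_norml => /andP[? _].
by lra.
Qed.

Lemma C1_torusN (phi : V -> R) : C1_torus phi ->
  C1_torus (fun x => - phi x) /\ grad (fun x => - phi x) = (fun x => - grad phi x).
Proof.
move=> [pphi dphi cphi]; have hg := has_gradN (has_gradP dphi).
split; last exact: grad_has_grad hg.
apply: (C1_torus_has_grad _ hg) => [x k|]; first by rewrite pphi.
exact: continuous_vopp.
Qed.

Lemma superdiffN (u : V -> R) (x p : V) :
  superdiff (fun y => - u y) x p <-> subdiff u x (- p).
Proof.
split=> -[phi [C1phi umax pE]].
  have [C1N gN] := C1_torusN C1phi.
  exists (fun y => - phi y); split=> //; last by rewrite gN pE.
  by move=> y; have := umax y; lra.
have [C1N gN] := C1_torusN C1phi.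
exists (fun y => - phi y); split=> //; last by rewrite gN -pE opprK.
by move=> y; have := umax y; lra.
Qed.

Lemma subdiff_enorm_le (u : V -> R) (x p : V) (C : R) : 0 <= C ->
  (forall y z, `|u y - u z| <= C * enorm (y - z)) -> subdiff u x p -> enorm p <= C.
Proof.
move=> C0 uC up; rewrite -enormN.
apply: (@superdiff_enorm_le (fun y => - u y) x) => // [y z|].
  by rewrite -opprD normrN.
by apply/superdiffN; rewrite opprK.
Qed.

End DirectionalDerivative.

Section EffectiveHamiltonian.
Context (R : realType) (N : nat).
Local Notation V := 'rV[R]_N.
Context (sigma : V -> R) (m : R -> R) (smax Lm : R).
Hypothesis sigma_periodic : torus_periodic sigma.
Hypothesis sigma_continuous : continuous sigma.
Hypothesis sigma_gt0 : forall x, 0 < sigma x.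
Hypothesis sigma_le : forall x, sigma x <= smax.
Hypothesis m_range : forall r, 0 <= r -> 0 < m r < 1.
Hypothesis Lm_ge0 : 0 <= Lm.
Hypothesis m_lip : forall r s, 0 <= r -> 0 <= s -> `|m r - m s| <= Lm * `|r - s|.

Definition ham (x p : V) : R := sigma x * m (enorm p).

Lemma m_enorm_lip (p q : V) : `|m (enorm p) - m (enorm q)| <= Lm * enorm (p - q).
Proof.
apply: le_trans (m_lip (enorm_ge0 _) (enorm_ge0 _)) _.
by rewrite ler_wpM2l// enorm_lipschitz.
Qed.

Lemma ham_lip x p q : `|ham x p - ham x q| <= smax * Lm * enorm (p - q).
Proof.
rewrite /ham -mulrBr normrM gtr0_norm// -mulrA.
by apply: ler_pM => //; [exact: ltW|exact: m_enorm_lip].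
Qed.

Lemma ham_unif_cont : torus_unif_cont ham.
Proof.
move=> eta eta0.
have [d d0 sd] := torus_modulus sigma_continuous sigma_periodic eta0.
exists d => // x y p /sd le; rewrite /ham -mulrBl normrM.
have /andP[m0 m1] := m_range (enorm_ge0 p).
by rewrite (gtr0_norm m0) -[leRHS]mulr1; apply: ler_pM => //; exact: ltW.
Qed.

Lemma continuous_m_enorm : continuous (fun p : V => m (enorm p)).
Proof. exact: (enorm_lipschitz_continuous m_enorm_lip). Qed.

Lemma max0_lip (a b : R) : `|Num.max a 0 - Num.max b 0| <= `|a - b|.
Proof.
rewrite ler_norml; case: (leP a 0) => ha; case: (leP b 0) => hb; apply/andP; split;
  have := ler_norm (a - b); have := ler_norm (b - a); rewrite distrC; lra.
Qed.

(* The perturbation [k] is what makes solutions of the discounted equation exact cell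
   solutions. *)
Definition coercive_ham (k : V -> R) (n : nat) (x p : V) : R :=
  ham x p + k x + Num.max (enorm p - n%:R) 0.

Section Perturbation.
Context (k : V -> R).
Hypothesis k_periodic : torus_periodic k.
Hypothesis k_continuous : continuous k.

Lemma coercive_ham_lip n x p q :
  `|coercive_ham k n x p - coercive_ham k n x q| <= (smax * Lm + 1) * enorm (p - q).
Proof.
have -> : coercive_ham k n x p - coercive_ham k n x q = (ham x p - ham x q) +
  (Num.max (enorm p - n%:R) 0 - Num.max (enorm q - n%:R) 0) by rewrite /coercive_ham; ring.
rewrite mulrDl mul1r; apply: le_trans (ler_normD _ _) _; apply: lerD; first exact: ham_lip.
apply: le_trans (max0_lip _ _) _; rewrite opprD opprK addrACA addNr addr0.
exact: enorm_lipschitz.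
Qed.

Lemma coercive_ham_unif_cont n : torus_unif_cont (coercive_ham k n).
Proof.
move=> eta eta0; have eta20 : 0 < eta / 2 by rewrite divr_gt0.
have [d d0 hd] := ham_unif_cont eta20.
have [d' d'0 kd] := torus_modulus k_continuous k_periodic eta20.
exists (Num.min d d') => [|x y p]; first by rewrite lt_min d0.
rewrite le_min => /andP[xyd /kd h2]; have h1 := hd x y p xyd.
have -> : coercive_ham k n x p - coercive_ham k n y p = (ham x p - ham y p) +
  (k x - k y) by rewrite /coercive_ham; ring.
by rewrite [eta]splitr; apply: le_trans (ler_normD _ _) _; exact: lerD.
Qed.

Lemma torus_hamiltonian_coercive n : torus_hamiltonian (coercive_ham k n).
Proof.
split=> [p x l|]; first by rewrite /coercive_ham /ham sigma_periodic k_periodic.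
refine (continuous_add (continuous_add (continuous_mul _ _) _) _).
- exact: (continuous_compose sigma_continuous (@continuous_fst _ _)).
- exact: (continuous_compose continuous_m_enorm (@continuous_snd _ _)).
- exact: (continuous_compose k_continuous (@continuous_fst _ _)).
refine (continuous_compose (_ : continuous (fun p : V => Num.max (enorm p - n%:R) 0))
  (@continuous_snd _ _)).
apply: (@enorm_lipschitz_continuous _ _ _ 1) => p q; rewrite mul1r.
apply: le_trans (max0_lip _ _) _; rewrite opprD opprK addrACA addNr addr0.
exact: enorm_lipschitz.
Qed.

Lemma coercive_coercive_ham n : coercive (coercive_ham k n).
Proof.
have [B kB] := torus_bounded k_continuous k_periodic.
apply/cvgeyPge => A; near=> r.
apply: le_ereal_inf_tmp => _ [[x p] /= rp <-]; rewrite lee_fin /coercive_ham.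
have : 0 < ham x p.
  by have /andP[m0 _] := m_range (enorm_ge0 p); rewrite mulr_gt0.
have := kB x; rewrite ler_norml => /andP[kx _].
have : enorm p - n%:R <= Num.max (enorm p - n%:R) 0 by rewrite le_max lexx.
have : A + B + n%:R <= r by near: r; apply: nbhs_pinfty_ge; rewrite num_real.
by lra.
Unshelve. all: by end_near. Qed.

Lemma effective_coercive_ham n P C a v : 0 <= C -> C + enorm P <= n%:R ->
  (forall x y, `|v x - v y| <= C * enorm (x - y)) ->
  cell_solution (fun x p => ham x p + k x) P a v ->
  effective_hamiltonian (coercive_ham k n) P = a.
Proof.
move=> C0 Cn vC [pv lv [subv supv]].
have hamE x p : enorm p <= C -> coercive_ham k n x (p + P) = ham x (p + P) + k x.
  move=> pC; rewrite /coercive_ham max_r ?addr0// subr_le0.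
  by apply: le_trans (enormD _ _) _; apply: le_trans Cn; rewrite lerD2r.
have cell : cell_solution (coercive_ham k n) P a v.
  split=> //; split=> x p px; rewrite hamE.
  - exact: subv.
  - exact: superdiff_enorm_le vC px.
  - exact: supv.
  - exact: subdiff_enorm_le vC px.
apply: xget_unique => [|b [w [pw [L wL] [subw supw]]]]; first by exists v.
have cv := enorm_lipschitz_continuous vC; have cw := enorm_lipschitz_continuous wL.
have [_ _ [subv' supv']] := cell.
apply/eqP; rewrite eq_le.
have ab := cell_comparison (@coercive_ham_unif_cont n) (@coercive_ham_lip n) cv pv cw pw subv' supw.
have ba := cell_comparison (@coercive_ham_unif_cont n) (@coercive_ham_lip n) cw pw cv pv subw supv'.
by move: ab ba; rewrite subrr enorm0 mulr0 !addr0 => -> ->.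
Qed.

End Perturbation.

Lemma approximating_coercive_ham (k : nat -> V -> R) :
  (forall n, torus_periodic (k n)) -> (forall n, continuous (k n)) ->
  (forall e, 0 < e -> \forall n \near \oo, forall x, `|k n x| <= e) ->
  approximating_sequence ham (fun n => coercive_ham (k n) n).
Proof.
move=> pk ck k0; split.
- by move=> n; exact: torus_hamiltonian_coercive.
- by move=> n; exact: coercive_coercive_ham.
- move=> r r0; apply/limn_einf_ge0P => e e0; near=> n.
  apply: le_ereal_inf_tmp => _ [[x p] /= pr <-]; rewrite lee_fin /coercive_ham.
  have : `|k n x| <= e by move: x {pr}; near: n; exact: k0.
  rewrite ler_norml => /andP[_ kx].
  have rn : r <= n%:R by near: n; exact: nbhs_infty_ger.
  rewrite max_r; first by lra.
  by rewrite subr_le0 (le_trans pr).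
- apply/limn_esup_le0P => e e0; near=> n.
  apply: ge_ereal_sup => _ [[x p] /= _ <-]; rewrite lee_fin /coercive_ham.
  have : `|k n x| <= e by move: x; near: n; exact: k0.
  rewrite ler_norml => /andP[kx _].
  have : 0 <= Num.max (enorm p - n%:R) 0 by rewrite le_max lexx orbT.
  by lra.
Unshelve. all: by end_near. Qed.

Lemma effective_limit (Hinf : V -> R) (P : V) (C : R)
    (k v : nat -> V -> R) (a : nat -> R) :
  generalized_effective_hamiltonian ham Hinf -> 0 <= C ->
  (forall n, torus_periodic (k n)) -> (forall n, continuous (k n)) ->
  (forall e, 0 < e -> \forall n \near \oo, forall x, `|k n x| <= e) ->
  (forall n x y, `|v n x - v n y| <= C * enorm (x - y)) ->
  (forall n, cell_solution (fun x p => ham x p + k n x) P (a n) (v n)) ->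
  forall e, 0 < e -> \forall n \near \oo, `|a n - Hinf P| <= e.
Proof.
move=> HinfP C0 pk ck k0 vC cell e e0.
have [h1 h2] := HinfP _ (approximating_coercive_ham pk ck k0).
have P1 : 0 < enorm P + 1 by rewrite ltr_wpDl// enorm_ge0.
have {h1}/limn_einf_ge0P h1 := h1 _ P1.
move/limn_esup_le0P in h2.
near=> n.
have Hn : effective_hamiltonian (coercive_ham (k n) n) P = a n.
  apply: (effective_coercive_ham (pk n) (ck n) C0 _ (vC n) (cell n)).
  by near: n; exact: nbhs_infty_ger.
rewrite distrC ler_norml -Hn -!lee_fin; apply/andP; split.
  have : ((- e)%:E <= ereal_inf
      [set (Hinf P - effective_hamiltonian (coercive_ham (k n) n) P)%:E |
          P in [set Q : V | (enorm Q <= enorm P + 1)%R]])%E by near: n; exact: h1.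
  move=> /le_trans; apply; apply: ereal_inf_lbound; exists P => //=.
  by rewrite lerDl.
have : (ereal_sup
      [set (Hinf P - effective_hamiltonian (coercive_ham (k n) n) P)%:E |
          P in [set: V]] <= e%:E)%E by near: n; exact: h2.
by apply: le_trans; apply: ereal_sup_ubound; exists P.
Unshelve. all: by end_near. Qed.

End EffectiveHamiltonian.

(** * Perron's method for the discounted cell problem *)

Section TestFunctions.
Context (R : realType) (N : nat).
Local Notation V := 'rV[R]_N.

Lemma grad_periodic (phi : V -> R) : torus_periodic phi -> torus_periodic (grad phi).
Proof.
move=> pphi x k; apply/rowP => i; rewrite !mxE /derive.
by under eq_fun do rewrite /= addrA !pphi.
Qed.

Lemma C1_torusD (f g : V -> R) : C1_torus f -> C1_torus g ->
  C1_torus (fun x => f x + g x) /\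
  grad (fun x => f x + g x) = (fun x => grad f x + grad g x).
Proof.
move=> [pf df cf] [pg dg cg]; have hg := has_gradD (has_gradP df) (has_gradP dg).
split; last exact: grad_has_grad hg.
apply: (C1_torus_has_grad _ hg) => [x k|]; first by rewrite pf pg.
exact: continuous_vadd.
Qed.

Lemma C1_torus_cst (c : R) : C1_torus (fun _ : V => c) /\ grad (fun _ : V => c) = (fun=> 0).
Proof.
have hg := @has_grad_cst R N c; split; last exact: grad_has_grad hg.
by apply: (C1_torus_has_grad _ hg) => //; exact: continuous_const.
Qed.

Lemma C1_torus_continuous (f : V -> R) : C1_torus f -> continuous f.
Proof. by move=> [_ df _] x; exact: differentiable_continuous. Qed.

Lemma superdiff_cst (c : R) (x p : V) : superdiff (fun=> c) x p -> p = 0.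
Proof.
move=> /(@superdiff_enorm_le _ _ _ _ _ 0 (lexx _)) h.
apply/eqP; rewrite -enorm_eq0 eq_le enorm_ge0 andbT; apply: h => y z.
by rewrite subrr normr0 mul0r.
Qed.

Lemma grad_eq_at_max (f g : V -> R) (x : V) : C1_torus f -> C1_torus g ->
  (forall y, f y - g y <= f x - g x) -> grad f x = grad g x.
Proof.
move=> Cf Cg fgmax; have [Cf' gf'] := C1_torusN Cf.
have [Ch gh] := C1_torusD Cg Cf'.
have : superdiff (fun=> 0) x (grad (fun x => g x + - f x) x).
  by exists (fun x => g x + - f x); split=> // y; have := fgmax y; lra.
by move/superdiff_cst; rewrite gh gf' => /eqP; rewrite subr_eq0 => /eqP.
Qed.

Lemma dpsi0 : dpsi (0 : V) = 0.
Proof. by apply/rowP => i; rewrite !mxE mulr0 sin0 mulr0 mul0r. Qed.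

End TestFunctions.

Section Perron.
Context (R : realType) (N : nat).
Local Notation V := 'rV[R]_N.
Context (sigma : V -> R) (m : R -> R) (smax smin Lm : R).
Hypothesis sigma_periodic : torus_periodic sigma.
Hypothesis sigma_continuous : continuous sigma.
Hypothesis sigma_gt0 : forall x, 0 < sigma x.
Hypothesis sigma_le : forall x, sigma x <= smax.
Hypothesis sigma_ge : forall x, smin <= sigma x.
Hypothesis smin_gt0 : 0 < smin.
Hypothesis m_range : forall r, 0 <= r -> 0 < m r < 1.
Hypothesis Lm_ge0 : 0 <= Lm.
Hypothesis m_lip : forall r s, 0 <= r -> 0 <= s -> `|m r - m s| <= Lm * `|r - s|.
Hypothesis m_mono : forall r s, 0 <= r -> r <= s -> m r <= m s.
Context (P : V) (lam R0 : R).
Hypothesis lam_gt0 : 0 < lam.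
Hypothesis R0_ge0 : 0 <= R0.
Let a0 := smax * m (enorm P).
Hypothesis a0_lt : a0 < smin * m R0.
Let C := R0 + enorm P.
Local Notation H := (ham sigma m).

Let C_ge0 : 0 <= C. Proof. by rewrite addr_ge0// enorm_ge0. Qed.

Let ham_gt0 x p : 0 < H x p.
Proof. by have /andP[m0 _] := m_range (enorm_ge0 p); rewrite mulr_gt0. Qed.

Let ham_P_le x : H x P <= a0.
Proof. by have /andP[m0 _] := m_range (enorm_ge0 P); rewrite ler_wpM2r// ltW. Qed.

Let coercivity x q : H x (q + P) <= a0 -> enorm q <= C.
Proof.
move=> h; have : enorm (q + P) <= R0.
  rewrite leNgt; apply/negP => /ltW /(m_mono R0_ge0) mR.
  have /andP[m0 _] := m_range R0_ge0.
  have : smin * m R0 <= H x (q + P) by apply: ler_pM => //; exact: ltW.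
  by move: h a0_lt; lra.
by have := enormB (q + P) P; rewrite addrK /C; lra.
Qed.

Let ham_continuous (g : V -> V) : continuous g -> continuous (fun x => H x (g x)).
Proof.
move=> cg; refine (continuous_mul sigma_continuous _).
exact: (continuous_compose (continuous_m_enorm Lm_ge0 m_lip) cg).
Qed.

Definition subsolution_class (v : V -> R) : Prop :=
  [/\ torus_periodic v, forall x y, `|v x - v y| <= C * enorm (x - y),
      forall x, - (a0 / lam) <= v x <= 0
    & torus_subsolution (fun x p => lam * v x + H x (p + P)) v].

Definition perron (x : V) : R := sup [set v x | v in subsolution_class].

Lemma subsolution_class_cst : subsolution_class (fun=> - (a0 / lam)).
Proof.
split=> // [x y|x|x p /superdiff_cst ->].
- by rewrite subrr normr0 mulr_ge0// enorm_ge0.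
- rewrite lexx oppr_le0 divr_ge0// ?ltW//.
  exact: lt_le_trans (ham_gt0 0 P) (ham_P_le 0).
- by rewrite add0r mulrN mulrCA mulfV ?gt_eqF// mulr1 addrC subr_le0.
Qed.

Lemma has_sup_perron x : has_sup [set v x | v in subsolution_class].
Proof.
split; first by exists (- (a0 / lam)), (fun=> - (a0 / lam)) => //; exact: subsolution_class_cst.
by exists 0 => _ [v [_ _ /(_ x)/andP[_ v0] _] <-].
Qed.

Lemma perron_ge v x : subsolution_class v -> v x <= perron x.
Proof. by move=> cv; apply: (sup_upper_bound (has_sup_perron x)); exists v. Qed.

Lemma perron_le x b : (forall v, subsolution_class v -> v x <= b) -> perron x <= b.
Proof.
move=> h; apply: ge_sup; first by have [] := has_sup_perron x.
by move=> _ [v cv <-]; exact: h.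
Qed.

Lemma perron_periodic : torus_periodic perron.
Proof.
move=> x k; apply/eqP; rewrite eq_le; apply/andP; split; apply: perron_le => v cv;
  have [pv _ _ _] := cv; first by rewrite pv perron_ge.
by rewrite -(pv x k) perron_ge.
Qed.

Lemma perron_lip x y : `|perron x - perron y| <= C * enorm (x - y).
Proof.
have half u w : perron u <= perron w + C * enorm (u - w).
  apply: perron_le => v cv; have [_ /(_ u w) vL _ _] := cv.
  by have := perron_ge w cv; move: vL; rewrite ler_norml => /andP[? ?]; lra.
rewrite ler_norml; have := half x y; have := half y x.
by rewrite [enorm (y - x)]enormBC => ? ?; apply/andP; split; lra.
Qed.

Lemma perron_bounds x : - (a0 / lam) <= perron x <= 0.
Proof.
apply/andP; split; first exact: (perron_ge x subsolution_class_cst).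
by apply: perron_le => v [_ _ /(_ x)/andP[]].
Qed.

Lemma perron_subsolution : torus_subsolution (fun x p => lam * perron x + H x (p + P)) perron.
Proof.
have arith1 (a b c d r s t : R) : a - d < b -> b - c <= r - s -> - t <= s - r -> d <= t ->
    a <= c + 2 * t by lra.
have arith2 (a b c d l t e : R) : a <= b + l * (2 * t) -> b + c <= 0 -> - t <= c - d ->
    (2 * l + 1) * t = e -> a + d <= e by lra.
move=> x p [phi [Cphi phimax pE]]; have [pphi _ cphi] := Cphi.
apply/ler_addgt0Pr => e e0; rewrite add0r.
pose eta := e / (2 * lam + 1).
have eta0 : 0 < eta by rewrite divr_gt0// addr_gt0// mulr_gt0.
have [Cpsi gpsi] := C1_psi 1 x.
have [Ct gt] := C1_torusD Cphi Cpsi.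
pose E y := H y (grad (fun y => phi y + 1 * psi (y - x)) y + P).
have cE : continuous E.
  apply: ham_continuous; refine (continuous_vadd _ (@continuous_const _ _ _)).
  by case: Ct.
have pE' : torus_periodic E.
  move=> y k; rewrite /E /ham sigma_periodic.
  by case: Ct => /grad_periodic -> _ _.
have [d1 d10 Ed] := torus_modulus cE pE' eta0.
have [d2 d20 phid] := torus_modulus (C1_torus_continuous Cphi) pphi eta0.
pose d := Num.min eta (Num.min d1 d2).
have d0 : 0 < d by rewrite !lt_min eta0 d10.
have [_ [v cv <-] vx] := sup_adherent d0 (has_sup_perron x).
rewrite -/(perron x) in vx.
have [pv vL _ subv] := cv.
have cont_v := enorm_lipschitz_continuous vL.
have [] := @torus_max _ _ (fun y => v y - (phi y + 1 * psi (y - x))).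
- by refine (continuous_sub cont_v _); exact: C1_torus_continuous.
- by move=> y k; rewrite pv; case: Ct => ->.
move=> y ymax.
have := ymax x; rewrite subrr psi0 => h1.
have h2 := perron_ge y cv; have h3 := phimax y.
have psid : psi (y - x) <= d by lra.
move: (psid); rewrite !le_min => /and3P[_ yd1 yd2].
have {}h1 : v x - v y <= phi x - phi y by have := psi_ge0 (y - x); lra.
have /subv : superdiff v y (grad (fun y => phi y + 1 * psi (y - x)) y) by eexists; split; eauto.
rewrite -/(E y) => h4.
have := Ed _ _ yd1; have := phid _ _ yd2; rewrite !ler_norml => /andP[h5 _] /andP[h6 _].
have <- : E x = H x (p + P) by rewrite /E gt gpsi subrr dpsi0 scaler0 addr0 pE.
have h7 : d <= eta by rewrite /d ge_min lexx.
have h8 : lam * perron x <= lam * v y + lam * (2 * eta).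
  by rewrite -mulrDr ler_pM2l//; exact: arith1 vx h1 h5 h7.
have h9 : (2 * lam + 1) * eta = e by rewrite /eta mulrC divfK// gt_eqF// addr_gt0// mulr_gt0.
exact: arith2 h8 h4 h6 h9.
Qed.

(* If [perron] fails the supersolution test at [x], lifting the test function by [d]
   near [x] yields a larger member of the class. *)
Section Bump.
Context (x : V) (phi : V -> R).
Hypothesis phi_C1 : C1_torus phi.
Hypothesis phi_touch : forall y, perron x - phi x <= perron y - phi y.

Let b y := phi y + (perron x - phi x) + - 1 * psi (y - x).
Let E y := lam * b y + H y (grad b y + P).
Context (d : R).
Hypothesis d_gt0 : 0 < d.
Hypothesis E_near : forall y, psi (y - x) <= d -> E y + lam * d < 0.

Let b_C1 : C1_torus b.
Proof.
have [C1 _] := C1_psi (-1) x; have [C2 _] := @C1_torus_cst R N (perron x - phi x).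
by have [C3 _] := C1_torusD phi_C1 C2; have [] := C1_torusD C3 C1.
Qed.

Let w y := Num.max (perron y) (b y + d).

Let bumped y : perron y < b y + d -> E y + lam * d < 0.
Proof.
by move=> h; apply: E_near; move: h (phi_touch y); rewrite /b; lra.
Qed.

Let bumped_grad y : perron y < b y + d -> enorm (grad b y) <= C.
Proof.
move=> h; apply: (coercivity (x := y)).
have /andP[+ _] := perron_bounds y; rewrite lerNl ler_pdivlMr// => h1.
have h2 : lam * perron y < lam * (b y + d) by rewrite ltr_pM2l.
by have := bumped h; rewrite /E; move: h1 h2; rewrite mulrDr; lra.
Qed.

Lemma bumped_lip y z : `|w y - w z| <= C * enorm (y - z).
Proof.
have cw : continuous w.
  rewrite (_ : w = fun y => 2^-1 * (perron y + (b y + d) + `|perron y - (b y + d)|)).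
    have cp := enorm_lipschitz_continuous perron_lip.
    have cb : continuous (fun y => b y + d).
      refine (continuous_add _ (@continuous_const _ _ _)).
      exact: C1_torus_continuous.
    refine (continuous_mul (@continuous_const _ _ _) (continuous_add _ _)).
      exact: (continuous_add cp cb).
    exact: (continuous_abs (continuous_sub cp cb)).
  by apply/funext => u; rewrite /w maxr_absE mulrC.
suff half u t : w u <= w t + C * enorm (u - t).
  rewrite ler_norml; have := half y z; have := half z y.
  by rewrite [enorm (z - y)]enormBC => ? ?; apply/andP; split; lra.
have [->|ut] := eqVneq u t; first by rewrite subrr enorm0 mulr0 addr0.
set D := enorm (u - t).
have D0 : 0 < D by rewrite lt_def enorm_ge0 andbT enorm_eq0 subr_eq0.
apply/ler_addgt0Pr => e e0.
pose C' := C + e / D.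
have C'D : C' * D = C * D + e by rewrite /C' mulrDl divfK// gt_eqF.
pose line s := u + s *: (t - u).
have cline : continuous line.
  move=> s; apply: cvgD; first exact: cvg_cst.
  by apply: cvgZr_tmp; exact: cvg_id.
have [|s] := @EVT_max R (fun s => w (line s) + C' * D * s) 0 1 ler01.
  apply: continuous_subspaceT; refine (continuous_add (continuous_compose cw cline) _).
  by refine (continuous_mul (@continuous_const _ _ _) _); exact: continuous_ident.
rewrite in_itv/= => /andP[s0 s1] hmax.
have := hmax 0; rewrite in_itv/= lexx ler01 => /(_ isT).
rewrite {1}/line scale0r addr0 mulr0 addr0 => h0.
have line1 : line 1 = t by rewrite /line scale1r addrC subrK.
have [ws|ws] := leP (b (line s) + d) (perron (line s)).
  have := perron_lip (line s) t.
  have -> : line s - t = (1 - s) *: (u - t).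
    by rewrite /line; apply/rowP => i; rewrite !mxE; ring.
  rewrite enormZ [`|1 - s|]ger0_norm ?subr_ge0// -/D ler_norml => /andP[_ h1].
  have h2 : w (line s) = perron (line s) by apply: max_l.
  have h3 : perron t <= w t by rewrite /w le_max lexx.
  have : C' * D * s <= C * D * s + e.
    by rewrite C'D mulrDl lerD2l ger_pMr.
  by nra.
have [s1'|] := ltP s 1; last first.
  move=> s1'; have sE : s = 1 by apply/eqP; rewrite eq_le s1 s1'.
  by move: h0; rewrite sE line1 mulr1; lra.
have w2 : w (line s) = b (line s) + d by apply: max_r; exact: ltW.
have db : derivable b (line s) (t - u) by apply: diff_derivable; case: b_C1.
have Dgt : - (C' * D) < 'D_(t - u) b (line s).
  have hg : has_grad b (grad b) by apply: has_gradP; case: b_C1.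
  rewrite (has_grad_derive _ _ hg) ltrNl -dotvNl.
  apply: le_lt_trans (dotv_le _ _) _; rewrite enormN enormBC -/D C'D.
  by apply: (@le_lt_trans _ _ (C * D)); rewrite ?ltrDl// ler_pM2r// bumped_grad.
have [h h0' hh] := derive_gt_secant db Dgt.
pose r := Num.min (h / 2) (1 - s).
have r0 : 0 < r by rewrite lt_min divr_gt0//= subr_gt0.
have rh : r < h by rewrite /r gt_min; apply/orP; left; lra.
have rs : r <= 1 - s by rewrite /r ge_min lexx orbT.
have {}hh := hh r; rewrite r0 rh in hh; have {}hh := hh isT.
have lineE : line s + r *: (t - u) = line (s + r) by rewrite /line scalerDl addrA.
rewrite lineE in hh.
have := hmax (s + r); rewrite in_itv/= => /(_ _).
have -> : 0 <= s + r <= 1 by apply/andP; split; lra.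
move=> /(_ isT); have : b (line (s + r)) + d <= w (line (s + r)) by rewrite /w le_max lexx orbT.
by rewrite w2; lra.
Qed.

Lemma bumped_class : subsolution_class w.
Proof.
split.
- by move=> y k; rewrite /w perron_periodic; case: b_C1 => ->.
- exact: bumped_lip.
- move=> y; have /andP[h1 h2] := perron_bounds y.
  rewrite /w le_max h1/= ge_max h2/=.
  have [h3|h3] := leP (b y + d) (perron y); first exact: le_trans h3 h2.
  have := bumped h3; have := ham_gt0 y (grad b y + P); rewrite /E => h4 h5.
  by rewrite -(pmulr_rle0 _ lam_gt0); lra.
- move=> y p [chi [Cchi chimax pE]].
  have [h|h] := leP (b y + d) (perron y).
    have wy : w y = perron y by apply: max_l.
    rewrite wy; apply: perron_subsolution; exists chi; split=> // z.
    have : perron z <= w z by rewrite /w le_max lexx.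
    by have := chimax z; rewrite wy; lra.
  have wy : w y = b y + d by apply: max_r; exact: ltW.
  have -> : p = grad b y.
    rewrite pE; apply/esym; apply: (grad_eq_at_max b_C1 Cchi) => z.
    have : b z + d <= w z by rewrite /w le_max lexx orbT.
    by have := chimax z; rewrite wy; lra.
  by rewrite wy; have := bumped h; rewrite /E; lra.
Qed.

Lemma bump_contradiction : False.
Proof.
have := perron_ge x bumped_class.
have : b x + d <= w x by rewrite /w le_max lexx orbT.
by rewrite /b subrr psi0; move: d_gt0; lra.
Qed.

End Bump.

Lemma perron_supersolution :
  torus_supersolution (fun x p => lam * perron x + H x (p + P)) perron.
Proof.
have arith (r s t : R) : s < 0 -> r - s <= - s / 4 -> t <= - s / 4 -> r + t < 0.
  by lra.
move=> x p [phi [Cphi phimin pE]].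
rewrite leNgt; apply/negP => neg.
have [Cpsi gpsi] := C1_psi (-1) x.
have [Cc gc] := @C1_torus_cst R N (perron x - phi x).
have [C1 g1] := C1_torusD Cphi Cc.
have [Cb gb] := C1_torusD C1 Cpsi.
pose b y := phi y + (perron x - phi x) + - 1 * psi (y - x).
pose E y := lam * b y + H y (grad b y + P).
have cE : continuous E.
  refine (continuous_add _ _).
    refine (continuous_mul (@continuous_const _ _ _) _).
    exact: (C1_torus_continuous Cb).
  apply: ham_continuous; refine (continuous_vadd _ (@continuous_const _ _ _)).
  by case: Cb.
have pE' : torus_periodic E.
  move=> y k; rewrite /E /ham sigma_periodic.
  have -> : b (y + map_mx (fun z : int => z%:~R) k) = b y by case: Cb => /(_ y k).
  by case: Cb => /grad_periodic /(_ y k) ->.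
have Ex : E x = lam * perron x + H x (p + P).
  rewrite /E {1}/b subrr psi0 mulr0 addr0 [phi x + _]addrC subrK.
  by rewrite gb g1 gc gpsi subrr dpsi0 scaler0 !addr0 pE.
rewrite -Ex in neg.
have e0 : 0 < - E x / 4 by lra.
have [d d0 Ed] := torus_modulus cE pE' e0.
pose d' := Num.min d (- E x / 4 / lam).
have d'0 : 0 < d' by rewrite lt_min d0 divr_gt0.
apply: (@bump_contradiction x phi Cphi phimin d') => // y.
rewrite le_min => /andP[/Ed + _]; rewrite ler_norml => /andP[_ h].
have h' : lam * d' <= - E x / 4.
  by rewrite mulrC -ler_pdivlMr// /d' ge_min lexx orbT.
exact: (arith (E y) (E x) _ neg h h').
Qed.

End Perron.

Section Correctors.
Context (R : realType) (N : nat).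
Local Notation V := 'rV[R]_N.
Context (sigma : V -> R) (m : R -> R) (smax smin Lm : R).
Hypothesis sigma_periodic : torus_periodic sigma.
Hypothesis sigma_continuous : continuous sigma.
Hypothesis sigma_gt0 : forall x, 0 < sigma x.
Hypothesis sigma_le : forall x, sigma x <= smax.
Hypothesis sigma_ge : forall x, smin <= sigma x.
Hypothesis smin_gt0 : 0 < smin.
Hypothesis m_range : forall r, 0 <= r -> 0 < m r < 1.
Hypothesis Lm_ge0 : 0 <= Lm.
Hypothesis m_lip : forall r s, 0 <= r -> 0 <= s -> `|m r - m s| <= Lm * `|r - s|.
Hypothesis m_mono : forall r s, 0 <= r -> r <= s -> m r <= m s.
Hypothesis m_limit : m r @[r --> +oo] --> (1 : R).
Context (Hinf : V -> R).
Hypothesis HinfP : generalized_effective_hamiltonian (ham sigma m) Hinf.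
Local Notation H := (ham sigma m).

(* Each [e] may use its own corrector, so no exact solution of the cell problem is
   required. *)
Definition has_corrector (P : V) : Prop := forall e, 0 < e ->
  exists v, [/\ continuous v, torus_periodic v,
    torus_subsolution (fun x p => H x (p + P) - (Hinf P + e)) v
  & torus_supersolution (fun x p => H x (p + P) - (Hinf P - e)) v].

Lemma near_cell_solution_corrector P C (k v : nat -> V -> R) (a : nat -> R) :
  0 <= C ->
  (forall n, torus_periodic (k n)) -> (forall n, continuous (k n)) ->
  (forall e, 0 < e -> \forall n \near \oo, forall x, `|k n x| <= e) ->
  (forall n x y, `|v n x - v n y| <= C * enorm (x - y)) ->
  (forall n, cell_solution (fun x p => H x p + k n x) P (a n) (v n)) ->
  has_corrector P.
Proof.
move=> C0 pk ck k0 vC cell e e0.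
have e20 : 0 < e / 2 by rewrite divr_gt0.
have aP := effective_limit sigma_periodic sigma_continuous sigma_gt0 sigma_le m_range
  Lm_ge0 m_lip HinfP C0 pk ck k0 vC cell e20.
have [n [an kn]] : exists n, `|a n - Hinf P| <= e / 2 /\ forall x, `|k n x| <= e / 2.
  near \oo => n; exists n; split; first by near: n.
  by near: n; exact: k0.
have [pv _ [subv supv]] := cell n.
exists (v n); split=> //.
- exact: enorm_lipschitz_continuous (vC n).
- move=> x p /subv; have := kn x; move: an.
  by rewrite !ler_norml => /andP[? ?] /andP[? ?]; lra.
- move=> x p /supv; have := kn x; move: an.
  by rewrite !ler_norml => /andP[? ?] /andP[? ?]; lra.
Unshelve. all: by end_near. Qed.

Lemma solvable_corrector P : solvability_set H P -> has_corrector P.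
Proof.
move=> [v [a [pv [C vC] solv]]].
have vC' x y : `|v x - v y| <= `|C| * enorm (x - y).
  by apply: le_trans (vC x y) _; rewrite ler_wpM2r ?enorm_ge0// ler_norm.
apply: (@near_cell_solution_corrector P `|C| (fun _ _ => 0) (fun=> v) (fun=> a)) => //.
- by move=> _; exact: continuous_const.
- by move=> e e0; apply: nearW => n x; rewrite normr0 ltW.
- move=> n; split; [exact: pv|by exists C|].
  have [subv supv] := solv.
  by split=> x p px; rewrite addr0; [exact: subv|exact: supv].
Qed.

Lemma enorm_cube (x : V) : cube x -> enorm x <= Num.sqrt N%:R.
Proof.
move=> cx; apply: le_trans (enorm_le_norm x) _; rewrite -[leRHS]mulr1.
rewrite ler_wpM2l ?sqrtr_ge0//.
rewrite [leLHS]/Num.norm /= mx_normrE; apply/bigmax_leP; split=> // -[i j] _ /=.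
by rewrite ord1; have := cx j; rewrite in_itv/= => /andP[x0 x1]; rewrite ger0_norm.
Qed.

Lemma periodic_lipschitz_osc (v : V -> R) C : 0 <= C -> torus_periodic v ->
  (forall x y, `|v x - v y| <= C * enorm (x - y)) ->
  forall x, `|v x - v 0| <= C * Num.sqrt N%:R.
Proof.
move=> C0 pv vC x; have [l xl] := to_cube x.
rewrite -(pv x l); apply: le_trans (vC _ _) _; rewrite subr0.
by rewrite ler_wpM2l// enorm_cube.
Qed.

Lemma small_slope_corrector P : smax * m (enorm P) < smin -> has_corrector P.
Proof.
move=> Psmall.
have [R0 R00 PR0] : exists2 R0, 0 <= R0 & smax * m (enorm P) < smin * m R0.
  have lt1 : smax * m (enorm P) / smin < 1 by rewrite ltr_pdivrMr// mul1r.
  near (@pinfty_nbhs R) => r; exists r; first by near: r; exact: nbhs_pinfty_ge.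
  by rewrite [ltRHS]mulrC -ltr_pdivrMr//; near: r; exact: (cvgr_gt _ m_limit _ lt1).
pose C := R0 + enorm P; have C0 : 0 <= C by rewrite addr_ge0// enorm_ge0.
pose lam (n : nat) : R := n.+1%:R^-1.
have lam0 n : 0 < lam n by rewrite invr_gt0.
pose v n := perron sigma m smax P (lam n) R0.
have vC n x y : `|v n x - v n y| <= C * enorm (x - y).
  exact: (perron_lip sigma_gt0 sigma_le m_range P (lam0 n) R00).
have pv n : torus_periodic (v n).
  exact: (perron_periodic sigma_gt0 sigma_le m_range P (lam0 n) R00).
pose k n x := lam n * (v n x - v n 0).
apply: (@near_cell_solution_corrector P C k v (fun n => - lam n * v n 0)) => //.
- by move=> n x l; rewrite /k pv.
- move=> n; refine (continuous_mul (@continuous_const _ _ _) _).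
  refine (continuous_sub (enorm_lipschitz_continuous (vC n)) (@continuous_const _ _ _)).
- move=> e e0; near=> n => x.
  rewrite /k normrM gtr0_norm//.
  apply: le_trans (ler_wpM2l (ltW (lam0 n)) (periodic_lipschitz_osc C0 (pv n) (vC n) x)) _.
  rewrite /lam mulrC ler_pdivrMr// -ler_pdivrMl//.
  apply: le_trans (_ : n%:R <= _); last by rewrite ler_nat.
  by near: n; exact: nbhs_infty_ger.
- move=> n; split; [exact: pv|by exists C; exact: vC|].
  have sub := perron_subsolution sigma_periodic sigma_continuous sigma_gt0 sigma_le
    m_range Lm_ge0 m_lip (lam0 n) R00.
  have sup := perron_supersolution sigma_periodic sigma_continuous sigma_gt0 sigma_le
    sigma_ge smin_gt0 m_range Lm_ge0 m_lip m_mono (lam0 n) R00 PR0.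
  split=> x p px; first by have := sub _ x p px; rewrite /k -/(v n); lra.
  by have := sup x p px; rewrite /k -/(v n); lra.
Unshelve. all: by end_near. Qed.

Lemma Hinf_lipschitz P Q : has_corrector P -> has_corrector Q ->
  `|Hinf P - Hinf Q| <= smax * Lm * enorm (P - Q).
Proof.
have half P' Q' : has_corrector P' -> has_corrector Q' ->
    Hinf Q' <= Hinf P' + smax * Lm * enorm (P' - Q').
  move=> cP cQ; apply/ler_addgt0Pr => e e0.
  have e20 : 0 < e / 2 by rewrite divr_gt0.
  have [v [cv pv subv _]] := cP _ e20; have [w [cw pw _ supw]] := cQ _ e20.
  have := cell_comparison (ham_unif_cont sigma_periodic sigma_continuous m_range)
    (ham_lip sigma_gt0 sigma_le Lm_ge0 m_lip) cv pv cw pw subv supw.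
  by lra.
move=> cP cQ; have := half _ _ cP cQ; have := half _ _ cQ cP.
by rewrite [enorm (Q - P)]enormBC ler_norml => ? ?; apply/andP; split; lra.
Qed.

End Correctors.

(** * Test functions for the Cauchy problems *)

Section RegularizedNorm.
Context (R : realType) (N : nat).
Local Notation V := 'rV[R]_N.
Implicit Types (x y z : V).

Lemma has_grad_shift (f : V -> R) (g : V -> V) (a : V) :
  has_grad f g -> has_grad (fun x => f (x - a)) (fun x => g (x - a)).
Proof.
move=> fg x; have h := fg (x - a).
have ht : is_diff x (fun y : V => y - a) id.
  have := @is_diffB R V V id (cst a) id 0 x (is_diff_id x) (is_diff_cst a x).
  by rewrite subr0.
exact: (@is_diff_comp R V V R (fun y => y - a) id f (dotv (g (x - a))) x ht h).
Qed.

Lemma has_grad_sqr_enorm : has_grad (fun x => enorm x ^+ 2) (fun x => 2 *: x).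
Proof.
apply: (eq_has_grad _ _ (has_grad_sum_coord
  (fun (i : 'I_N) (t : R) => is_derive_sqr (is_derive_id t 1)))) => x.
  by rewrite sqr_enorm.
by apply/rowP => i; rewrite !mxE mulr1.
Qed.

Context (eta : R).
Hypothesis eta_gt0 : 0 < eta.

Definition reg_norm x : R := Num.sqrt (enorm x ^+ 2 + eta ^+ 2).
Definition reg_dir x : V := (reg_norm x)^-1 *: x.

Lemma reg_norm0 : reg_norm 0 = eta.
Proof. by rewrite /reg_norm enorm0 expr0n add0r sqrtr_sqr gtr0_norm. Qed.

Lemma sqr_reg_norm x : reg_norm x ^+ 2 = enorm x ^+ 2 + eta ^+ 2.
Proof. by rewrite sqr_sqrtr// addr_ge0// sqr_ge0. Qed.

Lemma reg_norm_ge x : eta <= reg_norm x.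
Proof.
rewrite -[leLHS]gtr0_norm// -sqrtr_sqr ler_sqrt ?lerDr ?sqr_ge0//.
by rewrite addr_ge0// sqr_ge0.
Qed.

Lemma reg_norm_gt0 x : 0 < reg_norm x.
Proof. exact: lt_le_trans eta_gt0 (reg_norm_ge x). Qed.

Lemma enorm_le_reg x : enorm x <= reg_norm x.
Proof.
rewrite -[leLHS]ger0_norm ?enorm_ge0// -sqrtr_sqr ler_sqrt ?lerDl ?sqr_ge0//.
by rewrite addr_ge0// sqr_ge0.
Qed.

Lemma reg_norm_lip x y : `|reg_norm x - reg_norm y| <= enorm (x - y).
Proof.
have half u w : reg_norm u <= reg_norm w + enorm (u - w).
  have := enormD (u - w) w; rewrite subrK => h.
  have a0 := enorm_ge0 (u - w); have w0 := reg_norm_gt0 w; have u0 := enorm_ge0 u.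
  rewrite -(@ler_pXn2r _ 2%N)// ?nnegrE ?(ltW (reg_norm_gt0 u))//; last first.
    by rewrite addr_ge0// ltW.
  have : enorm u ^+ 2 <= (enorm (u - w) + enorm w) ^+ 2.
    by rewrite ler_pXn2r// ?nnegrE ?addr_ge0 ?enorm_ge0.
  have := ler_wpM2l a0 (enorm_le_reg w).
  have := sqr_reg_norm u; have := sqr_reg_norm w.
  move: (enorm (u - w)) (enorm u) (enorm w) (reg_norm u) (reg_norm w) => a b c U W.
  by rewrite !expr2; lra.
rewrite ler_norml; have := half x y; have := half y x.
by rewrite [enorm (y - x)]enormBC => ? ?; apply/andP; split; lra.
Qed.

Lemma enorm_reg_dir x : enorm (reg_dir x) <= 1.
Proof.
rewrite enormZ gtr0_norm ?invr_gt0 ?reg_norm_gt0// mulrC ler_pdivrMr ?reg_norm_gt0//.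
by rewrite mul1r enorm_le_reg.
Qed.

Lemma reg_dir_lip x y : enorm (reg_dir x - reg_dir y) <= 2 / eta * enorm (x - y).
Proof.
have x0 := reg_norm_gt0 x; have y0 := reg_norm_gt0 y.
have -> : reg_dir x - reg_dir y =
    (reg_norm x)^-1 *: ((x - y) + (reg_norm y - reg_norm x) *: reg_dir y).
  apply/rowP => i; rewrite !mxE; field.
  by rewrite !gt_eqF.
rewrite enormZ gtr0_norm ?invr_gt0// mulrC ler_pdivrMr//.
apply: le_trans (enormD _ _) _; rewrite enormZ distrC.
have h1 : `|reg_norm x - reg_norm y| * enorm (reg_dir y) <= enorm (x - y).
  rewrite -[leRHS]mulr1; apply: ler_pM => //; first exact: enorm_ge0.
    exact: reg_norm_lip.
  exact: enorm_reg_dir.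
have h2 : enorm (x - y) * 2 <= 2 / eta * enorm (x - y) * reg_norm x.
  have h : 1 <= reg_norm x / eta by rewrite ler_pdivlMr// mul1r reg_norm_ge.
  have -> : 2 / eta * enorm (x - y) * reg_norm x = enorm (x - y) * 2 * (reg_norm x / eta).
    by ring.
  by rewrite -[leLHS]mulr1 ler_wpM2l// mulr_ge0 ?enorm_ge0.
by lra.
Qed.

Lemma has_grad_reg_norm : has_grad reg_norm reg_dir.
Proof.
have hq : has_grad (fun x => enorm x ^+ 2 + eta ^+ 2) (fun x => 2 *: x).
  apply: (eq_has_grad _ _ (has_gradD has_grad_sqr_enorm (@has_grad_cst R N (eta ^+ 2)))) => x //.
  by rewrite addr0.
have q0 x : 0 < enorm x ^+ 2 + eta ^+ 2 by rewrite ltr_wpDl ?sqr_ge0// exprn_gt0.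
apply: (eq_has_grad _ _ (has_grad_comp (h' := fun r => (2 * Num.sqrt r)^-1)
  (fun x => is_derive1_sqrt (q0 x)) hq)) => x //.
rewrite scalerA; congr (_ *: _); rewrite -/(reg_norm x).
by field; rewrite gt_eqF// reg_norm_gt0.
Qed.

Lemma continuous_reg_dir : continuous reg_dir.
Proof.
apply/continuousP_dist => x e e0.
pose D := 2 / eta * Num.sqrt N%:R + 1.
have D1 : 0 <= 2 / eta by rewrite divr_ge0// ltW.
have D0 : 0 < D by rewrite ltr_wpDl// mulr_ge0// sqrtr_ge0.
exists (e / D) => [|y xy]; first by rewrite divr_gt0.
apply: le_lt_trans (norm_le_enorm _) _; apply: le_lt_trans (reg_dir_lip x y) _.
apply: (@le_lt_trans _ _ (D * `|x - y|)); last by rewrite mulrC -ltr_pdivlMr.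
apply: (@le_trans _ _ (2 / eta * (Num.sqrt N%:R * `|x - y|))).
  by rewrite ler_wpM2l// enorm_le_norm.
by rewrite mulrA ler_wpM2r// lerDl.
Qed.

End RegularizedNorm.

Section SeparatedTestFunctions.
Context (R : realType) (N : nat).
Local Notation V := 'rV[R]_N.
Context (T : R) (f : V -> R) (g : V -> V) (h h' : R -> R).
Hypothesis fg : has_grad f g.
Hypothesis cg : continuous g.
Hypothesis hh' : forall t, t < T -> is_derive t 1 h (h' t).
Hypothesis ch' : forall t, t < T -> {for t, continuous h'}.

Let phi (z : V * R) := f z.1 + h z.2.

Lemma dx_separated z : dx phi z = g z.1.
Proof.
rewrite /dx /phi /= (grad_has_grad (has_gradD fg (@has_grad_cst R N (h z.2)))).
by rewrite addr0.
Qed.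

Lemma dt_separated z : z.2 < T -> dt phi z = h' z.2.
Proof.
move=> /hh' hz; rewrite /dt /phi /= derive1E.
have := @is_deriveD _ _ _ (cst (f z.1)) h z.2 1 _ _ (is_derive_cst _ _ _) hz.
by move=> hD; rewrite (@derive_val _ _ _ _ _ _ _ hD) add0r.
Qed.

Lemma C1_separated : C1_strip T phi.
Proof.
move=> z /andP[z0 zT]; split.
- have df : differentiable (f \o fst) z.
    apply: differentiable_comp; first exact: linear_differentiable (@continuous_fst _ _).
    exact: has_grad_differentiable fg.
  have dh : differentiable (h \o snd) z.
    apply: differentiable_comp; first exact: linear_differentiable (@continuous_snd _ _).
    by apply/derivable1_diffP; have := hh' zT; case.
  exact: differentiableD df dh.
- rewrite (_ : dx phi = fun z => g z.1); last by apply/funext => w; exact: dx_separated.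
  exact: (continuous_compose cg (@continuous_fst _ _)).
- rewrite /prop_for /continuous_at dt_separated//.
  have nT : \forall w \near z, h' w.2 = dt phi w.
    have : \forall w \near z, w.2 < T.
      have h2 : nbhs z.2 (fun t => t < T) by exact: lt_nbhsl.
      exact: (@continuous_snd V R z _ h2).
    by apply: filterS => w wT; rewrite dt_separated.
  apply: cvg_trans (near_eq_cvg nT) _.
  apply: (cvg_comp _ h' (@continuous_snd V R z)).
  exact: ch'.
Qed.

End SeparatedTestFunctions.

Section TimePenalty.
Context (R : realType).
Implicit Types (T t a b c D k r s : R).

(* [k / (T - t)] keeps maximum points away from the terminal time. *)
Definition time_penalty T D a s b r k t : R :=
  D * t + a * (t - s) ^+ 2 + b * (t - r) ^+ 2 + k / (T - t).
Definition dtime_penalty T D a s b r k t : R :=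
  D + 2 * a * (t - s) + 2 * b * (t - r) + k / (T - t) ^+ 2.

Lemma is_derive_time_penalty T D a s b r k t : t < T ->
  is_derive t 1 (time_penalty T D a s b r k) (dtime_penalty T D a s b r k t).
Proof.
move=> tT; have Tt0 : T - t != 0 by rewrite gt_eqF// subr_gt0.
have d1 : is_derive t 1 (fun t => D * t) D.
  by have := is_derive_affine D 0 t; under eq_fun do rewrite addr0.
have dsq c u : is_derive t 1 (fun t => c * (t - u) ^+ 2) (c * (2 * (t - u))).
  have /is_derive_sqr := is_derive_affine 1 (- u) t; under eq_fun do rewrite mul1r.
  by rewrite mul1r mulr1 => h; exact: (@is_deriveZ _ _ _ _ c _ _ _ h).
have dT : is_derive t 1 (fun t => k / (T - t)) (k * ((T - t) ^- 2)).
  have h0 : is_derive t 1 (fun t => T - t) (-1).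
    by have := is_derive_affine (-1) T t; under eq_fun do rewrite mulN1r addrC.
  have := @is_deriveV R (fun t => T - t) t _ _ Tt0 h0.
  rewrite /GRing.scale/= mulrN1 opprK => h.
  exact: (@is_deriveZ _ _ _ _ k _ _ _ h).
have := is_deriveD (is_deriveD (is_deriveD d1 (dsq a s)) (dsq b r)) dT.
rewrite /dtime_penalty => h; apply: (is_derive_eq h); ring.
Qed.

Lemma continuous_dtime_penalty T D a s b r k t : t < T ->
  {for t, continuous (dtime_penalty T D a s b r k)}.
Proof.
move=> tT; have Tt0 : (T - t) ^+ 2 != 0 by rewrite sqrf_eq0 gt_eqF// subr_gt0.
have caff c u : continuous (fun t : R => 2 * c * (t - u)).
  refine (continuous_mul (@continuous_const _ _ _) _).
  exact: (continuous_sub (@continuous_ident _) (@continuous_const _ _ _)).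
have cT : continuous (fun t : R => (T - t) ^+ 2).
  have cs : continuous (fun t : R => T - t).
    exact: (continuous_sub (@continuous_const _ _ _) (@continuous_ident _)).
  exact: (continuous_mul cs cs).
have c1 : continuous (fun t : R => D + 2 * a * (t - s) + 2 * b * (t - r)).
  exact: (continuous_add (continuous_add (@continuous_const _ _ _) (caff a s)) (caff b r)).
apply: (cvgD (c1 t)); apply: (cvgM (cvg_cst k)).
by apply: (cvgV Tt0); exact: cT.
Qed.

End TimePenalty.

Section SeparatedViscosity.
Context (R : realType) (N : nat).
Local Notation V := 'rV[R]_N.
Context (T : R) (F : V -> V -> R) (u : V * R -> R) (f : V -> R) (g : V -> V).
Hypothesis fg : has_grad f g.
Hypothesis cg : continuous g.

Lemma subsolution_separated D a s b r k (z : V * R) :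
  cauchy_subsolution T F u -> open_strip T z ->
  (\forall w \near z, u w - (f w.1 + time_penalty T D a s b r k w.2) <=
     u z - (f z.1 + time_penalty T D a s b r k z.2)) ->
  dtime_penalty T D a s b r k z.2 + F z.1 (g z.1) <= 0.
Proof.
move=> subu zT zmax; have /andP[_ zT'] := zT.
have hh' t := @is_derive_time_penalty R T D a s b r k t.
have ch' t := @continuous_dtime_penalty R T D a s b r k t.
have := subu _ z (@C1_separated R N T f g _ _ fg cg hh' ch') zT zmax.
by rewrite (dx_separated _ fg) (dt_separated _ hh').
Qed.

Lemma supersolution_separated D a s b r k (z : V * R) :
  cauchy_supersolution T F u -> open_strip T z ->
  (\forall w \near z, u z - (f z.1 + time_penalty T D a s b r k z.2) <=
     u w - (f w.1 + time_penalty T D a s b r k w.2)) ->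
  0 <= dtime_penalty T D a s b r k z.2 + F z.1 (g z.1).
Proof.
move=> supu zT zmin; have /andP[_ zT'] := zT.
have hh' t := @is_derive_time_penalty R T D a s b r k t.
have ch' t := @continuous_dtime_penalty R T D a s b r k t.
have := supu _ z (@C1_separated R N T f g _ _ fg cg hh' ch') zT zmin.
by rewrite (dx_separated _ fg) (dt_separated _ hh').
Qed.

End SeparatedViscosity.

Section Clamp.
Context (R : realType) (N : nat).
Local Notation V := 'rV[R]_N.
Implicit Types (T t r : R).

Definition clamp (T1 t : R) : R := Num.max 0 (Num.min t T1).

Lemma clamp_id (T1 t : R) : 0 <= t <= T1 -> clamp T1 t = t.
Proof. by move=> /andP[t0 tT]; rewrite /clamp min_l// max_r. Qed.

Lemma clamp_itv (T1 t : R) : 0 <= T1 -> 0 <= clamp T1 t <= T1.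
Proof.
by move=> T10; rewrite /clamp le_max lexx/= ge_max T10/= ge_min lexx orbT.
Qed.

Lemma continuous_clamp (T1 : R) : continuous (clamp T1).
Proof.
move=> t; apply: (@continuous_max R R (cst 0) (fun t => Num.min t T1)).
  exact: cvg_cst.
by apply: (@continuous_min R R id (cst T1)); [exact: cvg_id|exact: cvg_cst].
Qed.

Lemma continuous_inverse (X : topologicalType) (f : X -> R) :
  (forall x, f x != 0) -> continuous f -> continuous (fun x => (f x)^-1).
Proof. by move=> f0 cf x; apply: (cvgV (f0 x)); exact: cf. Qed.

Lemma continuous_pairing (X Y Z : topologicalType) (f : X -> Y) (g : X -> Z) :
  continuous f -> continuous g -> continuous (fun x => (f x, g x)).
Proof. by move=> cf cg x; exact: (cvg_pair (cf x) (cg x)). Qed.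

Lemma continuous_clamp_strip (T T1 : R) (W : V * R -> R) : 0 <= T1 < T ->
  {within strip T, continuous W} -> continuous (fun z => W (z.1, clamp T1 z.2)).
Proof.
move=> /andP[T10 T1T] /subspace_continuousP cW z.
pose q (z : V * R) := (z.1, clamp T1 z.2).
have cq : continuous q.
  apply: continuous_pairing; first exact: continuous_fst.
  exact: (continuous_compose (@continuous_clamp T1) (@continuous_snd _ _)).
have qs w : strip T (q w).
  by have /andP[h1 h2] := clamp_itv w.2 T10; rewrite /strip/= h1 (le_lt_trans h2).
apply: (@cvg_comp _ _ _ q W _ (within (strip T) (nbhs (q z)))); last exact: cW.
move=> A hA; have : nbhs z (q @^-1` [set w | strip T w -> A w]) := cq z _ hA.
by apply: filterS => w; apply; exact: qs.
Qed.

Definition box r : set V := [set x | forall i, x 0 i \in `[- r, r]].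

Lemma compact_box r : compact (box r).
Proof.
have := @rV_compact R N (fun=> `[- r, r]%classic) (fun=> @segment_compact R (- r) r).
by rewrite (_ : [set _ | _] = box r).
Qed.

Lemma enorm_box r x : enorm x <= r -> box r x.
Proof.
move=> xr i; rewrite in_itv/= -ler_norml.
exact: le_trans (coord_le_enorm x i) xr.
Qed.

Lemma near_enorm_lt r (x : V) : enorm x < r -> \forall y \near x, enorm y < r.
Proof.
move=> xr; have h : nbhs (enorm x) (fun s => s < r) by exact: lt_nbhsl.
exact: (@continuous_enorm R N x _ h).
Qed.

Lemma near_time (T1 : R) (z : V * R) (r : R) : enorm z.1 < r -> 0 < z.2 < T1 ->
  \forall w \near z, box r w.1 /\ 0 <= w.2 <= T1.
Proof.
move=> zr /andP[z0 zT].
have h1 : \forall w \near z, enorm w.1 < r.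
  have h := near_enorm_lt zr; exact: (@continuous_fst _ _ z _ h).
have h2 : \forall w \near z, 0 < w.2.
  have h : nbhs z.2 (fun s => 0 < s) by exact: lt_nbhsr.
  exact: (@continuous_snd _ _ z _ h).
have h3 : \forall w \near z, w.2 < T1.
  have h : nbhs z.2 (fun s => s < T1) by exact: lt_nbhsl.
  exact: (@continuous_snd _ _ z _ h).
near=> w; split.
  by apply: enorm_box; apply: ltW; near: w.
by apply/andP; split; apply: ltW; near: w.
Unshelve. all: by end_near. Qed.

End Clamp.

Section Barrier.
Context (R : realType) (N : nat).
Local Notation V := 'rV[R]_N.

Lemma time_barrier (T : R) (F : V -> V -> R) (W : V * R -> R) (u0 : V -> R) (c L B : R) :
  cauchy_subsolution T F W -> {within strip T, continuous W} ->
  (forall z, strip T z -> `|W z| <= B) -> 0 <= L ->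
  (forall x y, `|u0 x - u0 y| <= L * enorm (x - y)) ->
  (forall x, W (x, 0) = u0 x) -> 0 <= c -> (forall x p, - c <= F x p) ->
  forall x t, 0 <= t < T -> W (x, t) <= u0 x + c * t.
Proof.
move=> subW cW WB L0 u0L W0 c0 Fc x0 t0 /andP[t00 t0T].
have T0 : 0 < T by apply: le_lt_trans t00 t0T.
apply/ler_addgt0Pr => e e0; rewrite leNgt; apply/negP => Wlt.
have B0 : 0 <= B by apply: le_trans (WB (x0, t0) _) => //; apply/andP; split.
have u0B : `|u0 x0| <= B by rewrite -W0; apply: WB; rewrite /strip/= lexx.
pose k := e / 3 * (T - t0).
have Tt0 : 0 < T - t0 by rewrite subr_gt0.
have k0 : 0 < k by rewrite mulr_gt0// divr_gt0.
have kE : k / (T - t0) = e / 3 by rewrite /k mulfK// gt_eqF.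
pose a := L ^+ 2 / e + 2 * B + 1.
have Le0 : 0 <= L ^+ 2 / e by rewrite divr_ge0 ?sqr_ge0// ltW.
have a0 : 0 < a by rewrite /a; lra.
pose l := u0 x0 + e * 2 / 3.
pose T1 := T - k / (2 * B + 1).
have B1 : 0 < 2 * B + 1 by lra.
have T1T : T1 < T by rewrite /T1 ltrBlDr ltrDl divr_gt0.
pose f (x : V) : R := a * enorm (x - x0) ^+ 2.
have fg : has_grad f (fun x : V => a *: (2 *: (x - x0))).
  exact: (has_gradZ a (has_grad_shift x0 (@has_grad_sqr_enorm R N))).
have cg : continuous (fun x : V => a *: (2 *: (x - x0))).
  refine (continuous_scale (continuous_scale _)).
  exact: (continuous_vsub (@continuous_ident _) (@continuous_const _ _ _)).
pose tp := time_penalty T c 0 0 0 0 k.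
have tpE t : tp t = c * t + k / (T - t) by rewrite /tp /time_penalty; ring.
have interior (x : V) (t : R) : 0 <= t < T -> l < W (x, t) - (f x + tp t) ->
    [/\ 0 < t, t < T1 & enorm x < enorm x0 + 2].
  move=> /andP[tge0 tT]; rewrite tpE => hl.
  have Tt : 0 < T - t by rewrite subr_gt0.
  have kt : 0 < k / (T - t) by rewrite divr_gt0.
  have f0 : 0 <= f x by rewrite /f mulr_ge0 ?sqr_ge0// ltW.
  have ct : 0 <= c * t by rewrite mulr_ge0.
  have := WB (x, t); rewrite /strip/= tge0 tT => /(_ isT).
  move: u0B; rewrite !ler_norml => /andP[u1 _] /andP[_ w1].
  have fB : f x < 2 * B by rewrite /l in hl; lra.
  split.
  - rewrite lt_def tge0 andbT; apply/eqP => t00'; subst t.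
    have := u0L x x0; rewrite ler_norml => /andP[_ h1].
    move: hl; rewrite W0 mulr0 add0r /l /f => hl.
    set D := enorm (x - x0) in hl h1.
    have D0 : 0 <= D by exact: enorm_ge0.
    have h2 : L ^+ 2 / e * D ^+ 2 <= a * D ^+ 2.
      by rewrite ler_wpM2r ?sqr_ge0// /a; lra.
    have h3 : L * D <= L ^+ 2 / e * D ^+ 2 + e / 4.
      rewrite -subr_ge0.
      have -> : L ^+ 2 / e * D ^+ 2 + e / 4 - L * D = (L * D - e / 2) ^+ 2 / e.
        by field; rewrite gt_eqF.
      by rewrite divr_ge0 ?sqr_ge0// ltW.
    by rewrite subr0 in hl kt; lra.
  - have : k / (T - t) < 2 * B + 1 by rewrite /l in hl; lra.
    rewrite ltr_pdivrMr// mulrC -ltr_pdivrMr// /T1; lra.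
  - have : enorm (x - x0) < 1.
      rewrite ltNge; apply/negP => D1.
      have : 1 <= enorm (x - x0) ^+ 2 by rewrite -(expr1n _ 2) ler_pXn2r// ?nnegrE ?enorm_ge0.
      move: fB; rewrite /f /a; have := sqr_ge0 (enorm (x - x0)); nra.
    by have := enormD (x - x0) x0; rewrite subrK; lra.
have start : l < W (x0, t0) - (f x0 + tp t0).
  rewrite tpE kE /f subrr enorm0 expr0n mulr0 /l; lra.
have [_ t0T1 _] : [/\ 0 < t0, t0 < T1 & enorm x0 < enorm x0 + 2].
  by apply: interior => //; rewrite t00 t0T.
have T10 : 0 <= T1 by apply: le_trans t00 (ltW t0T1).
pose Phi (z : V * R) := W (z.1, clamp T1 z.2) - (f z.1 + tp (clamp T1 z.2)).
have cPhi : continuous Phi.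
  have cc : continuous (fun z : V * R => clamp T1 z.2).
    exact: (continuous_compose (@continuous_clamp R T1) (@continuous_snd _ _)).
  refine (continuous_sub _ _).
    by apply: (continuous_clamp_strip (T := T)) => //; rewrite T10.
  refine (continuous_add _ _).
    exact: (continuous_compose (has_grad_continuous fg) (@continuous_fst _ _)).
  rewrite (_ : (fun z => _) = fun z : V * R => c * clamp T1 z.2 + k * (T - clamp T1 z.2)^-1).
    refine (continuous_add (continuous_mul (@continuous_const _ _ _) cc)
      (continuous_mul (@continuous_const _ _ _) _)).
    apply: continuous_inverse; last exact: (continuous_sub (@continuous_const _ _ _) cc).
    move=> z; rewrite gt_eqF// subr_gt0.
    by have /andP[_ /le_lt_trans] := clamp_itv z.2 T10; apply.
  by apply/funext => z; rewrite tpE.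
pose Q := box (N := N) (enorm x0 + 2) `*` `[0, T1].
have Q0 : Q (x0, t0).
  split; first by apply: enorm_box; rewrite lerDl.
  by rewrite /= in_itv/= t00 ltW.
have [||| z zQ zmax] := @compact_EVT_max _ R Phi Q.
- by exists (x0, t0).
- by apply: compact_setX; [exact: compact_box|exact: segment_compact].
- exact: continuous_subspaceT.
rewrite inE in zQ; case: zQ => zQ1; rewrite /= in_itv/= => zQ2.
have PhiE w : 0 <= w.2 <= T1 -> Phi w = W w - (f w.1 + tp w.2).
  by move=> h; rewrite /Phi clamp_id//; case: w {h}.
have := zmax (x0, t0) (mem_set Q0).
rewrite !PhiE//=; last by rewrite t00 ltW.
move=> /(lt_le_trans start) lz.
have zT : 0 <= z.2 < T by case/andP: zQ2 => -> /le_lt_trans /=; apply.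
have [|z20 z2T1 z1r] := interior z.1 z.2 zT; first by rewrite -surjective_pairing.
have := @subsolution_separated R N T F W f _ fg cg c 0 0 0 0 k z subW.
have zo : open_strip T z by rewrite /open_strip/= z20; case/andP: zT.
move=> /(_ zo); rewrite -/tp.
have zloc : \forall w \near z, W w - (f w.1 + tp w.2) <= W z - (f z.1 + tp z.2).
  have := @near_time R N T1 z (enorm x0 + 2) z1r.
  rewrite z20 z2T1 => /(_ isT); apply: filterS => w [w1 w2].
  by rewrite -!PhiE//; apply: zmax; rewrite inE; split.
move=> /(_ zloc).
have := Fc z.1 (a *: (2 *: (z.1 - x0))).
have : 0 < k / (T - z.2) ^+ 2.
  by rewrite divr_gt0// exprn_gt0// subr_gt0; case/andP: zT.
rewrite /dtime_penalty; lra.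
Qed.

End Barrier.

(** * Perturbed test functions *)

Section Doubling.
Context (R : realType) (N : nat).
Local Notation V := 'rV[R]_N.
Context (G : V -> V -> R) (F : V -> R) (M : R).
Hypothesis M_ge0 : 0 <= M.
Hypothesis G_lip : forall x p q, `|G x p - G x q| <= M * enorm (p - q).
Context (T T1 T2 r1 r2 : R).
Hypothesis T1_gt0 : 0 < T1.
Hypothesis T1_ltT : T1 < T.
Hypothesis T2_gt0 : 0 < T2.
Hypothesis T2_ltT : T2 < T.
Context (W u : V * R -> R) (eps : R).
Hypothesis eps_gt0 : 0 < eps.
Hypothesis W_continuous : {within strip T, continuous W}.
Hypothesis u_continuous : {within strip T, continuous u}.
Hypothesis W_sub : cauchy_subsolution T (fun x p => G (eps^-1 *: x) p) W.
Hypothesis u_super : cauchy_supersolution T (fun _ p => F p) u.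
Context (Lp L1 eta beta A k l db d e1 Bv Lam ds : R).
Hypothesis Lp_gt0 : 0 < Lp.
Hypothesis eta_gt0 : 0 < eta.
Hypothesis k_gt0 : 0 < k.
Hypothesis Lam_gt0 : 0 < Lam.
Hypothesis F_lip : forall P Q, enorm P <= L1 -> enorm Q <= L1 ->
  `|F P - F Q| <= M * enorm (P - Q).
Hypothesis corrector : forall P, enorm P <= Lp -> exists v, [/\ continuous v,
  torus_periodic v, forall x, `|v x| <= Bv
  & torus_supersolution (fun x p => G x (p + P) - (F P - e1)) v].
Hypothesis G_modulus : forall x y p, psi (x - y) <= ds -> `|G x p - G y p| <= e1.
Hypothesis Lam_large : 2 * Bv <= Lam * ds.
Hypothesis d_ge0 : 0 <= d.
Hypothesis eps_small : 2 * Bv * eps <= d ^+ 2.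
Hypothesis d_small : Lp + 2 * d <= L1.
Hypothesis gain : 4 * d + 2 * e1 + M * (2 * (Lp * (2 / eta * (2 * d)) + 2 * d) + db) <
  k / T ^+ 2.

Definition doubled (z w : V * R) : R := W z - u w - (Lp * reg_norm eta (z.1 - w.1) +
  beta * enorm z.1 ^+ 2 + A * (z.2 - w.2) ^+ 2 + k / (T - z.2)).

Hypothesis interior : forall z w, 0 <= z.2 <= T1 -> 0 <= w.2 <= T2 -> l < doubled z w ->
  [/\ 0 < z.2 < T1, 0 < w.2 < T2, enorm z.1 < r1, enorm w.1 < r2
    & enorm (2 * beta *: z.1) <= db].

Let Q : set ((V * R) * (V * R)) := (box r1 `*` `[0, T1]) `*` (box r2 `*` `[0, T2]).

Let compactQ : compact Q.
Proof.
by do 2?apply: compact_setX; (exact: compact_box || exact: segment_compact).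
Qed.

Let cdoubled (y : (V * R) * (V * R)) : R :=
  doubled (y.1.1, clamp T1 y.1.2) (y.2.1, clamp T2 y.2.2).

Let cdoubledE y : Q y -> cdoubled y = doubled y.1 y.2.
Proof.
case: y => -[x t] [y s] [[/= _]]; rewrite in_itv/= => tT [_ /=]; rewrite in_itv/= => sT.
by rewrite /cdoubled /= !clamp_id.
Qed.

Let continuous_cdoubled : continuous cdoubled.
Proof.
have c1 := @continuous_fst (V * R)%type (V * R)%type.
have c2 := @continuous_snd (V * R)%type (V * R)%type.
have cx : continuous (fun y : (V * R) * (V * R) => y.1.1).
  exact: (continuous_compose (@continuous_fst _ _) c1).
have cy : continuous (fun y : (V * R) * (V * R) => y.2.1).
  exact: (continuous_compose (@continuous_fst _ _) c2).
have ct : continuous (fun y : (V * R) * (V * R) => clamp T1 y.1.2).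
  apply: (continuous_compose (@continuous_clamp R T1)).
  exact: (continuous_compose (@continuous_snd _ _) c1).
have cs : continuous (fun y : (V * R) * (V * R) => clamp T2 y.2.2).
  apply: (continuous_compose (@continuous_clamp R T2)).
  exact: (continuous_compose (@continuous_snd _ _) c2).
have T1T : 0 <= T1 < T by rewrite ltW.
have T2T : 0 <= T2 < T by rewrite ltW.
have csq (f : (V * R) * (V * R) -> R) : continuous f -> continuous (fun y => f y ^+ 2).
  by move=> cf; exact: (continuous_mul cf cf).
refine (continuous_sub (continuous_sub _ _) (continuous_add (continuous_add
  (continuous_add (continuous_mul (@continuous_const _ _ _) _)
  (continuous_mul (@continuous_const _ _ _) _)) (continuous_mul (@continuous_const _ _ _) _))
  (continuous_mul (@continuous_const _ _ _) _))).
- exact: (continuous_compose (continuous_clamp_strip T1T W_continuous) c1).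
- exact: (continuous_compose (continuous_clamp_strip T2T u_continuous) c2).
- apply: (continuous_compose (has_grad_continuous (has_grad_reg_norm eta_gt0))).
  exact: (continuous_vsub cx cy).
- by apply: csq; exact: (continuous_compose (@continuous_enorm R N) cx).
- by apply: csq; exact: (continuous_sub ct cs).
- apply: continuous_inverse; last exact: (continuous_sub (@continuous_const _ _ _) ct).
  move=> y; rewrite gt_eqF//= subr_gt0.
  by have /andP[_ /le_lt_trans] := clamp_itv y.1.2 (ltW T1_gt0); apply.
Qed.

Let dist2 (z z' w w' : V * R) : R := enorm (z.1 - z'.1) ^+ 2 + (z.2 - z'.2) ^+ 2 +
  enorm (w.1 - w'.1) ^+ 2 + (w.2 - w'.2) ^+ 2.

Let dist2_le z z' w w' : dist2 z z' w w' <= d ^+ 2 ->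
  [/\ enorm (z.1 - z'.1) <= d, `|z.2 - z'.2| <= d,
      enorm (w.1 - w'.1) <= d & `|w.2 - w'.2| <= d].
Proof.
rewrite /dist2 => h.
have h1 := sqr_ge0 (enorm (z.1 - z'.1)); have h2 := sqr_ge0 (z.2 - z'.2).
have h3 := sqr_ge0 (enorm (w.1 - w'.1)); have h4 := sqr_ge0 (w.2 - w'.2).
have sq (a : R) : 0 <= a -> a ^+ 2 <= d ^+ 2 -> a <= d.
  by move=> a0; rewrite ler_pXn2r// nnegrE.
by split; apply: sq; rewrite ?enorm_ge0// ?real_normK ?num_real//; lra.
Qed.

(* Perturbed test function method: at a maximum point (zh, wh) of the doubled
   functional the slope [P] is frozen, and the corrector for [P] is then inserted
   at a nearby maximum point of the localized functional. *)
Lemma doubling_perturbed : (exists z w, Q (z, w) /\ l + 2 * Bv * eps < doubled z w) ->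
  exists P v z w zh wh xi, [/\ enorm P <= Lp,
    [/\ P = Lp *: reg_dir eta (zh.1 - wh.1), continuous v,
        torus_periodic v, forall x, `|v x| <= Bv
      & torus_supersolution (fun x p => G x (p + P) - (F P - e1)) v],
    Q (z, w), l < doubled z w &
    [/\ dist2 z zh w wh <= d ^+ 2,
        psi (eps^-1 *: z.1 - xi) <= ds &
     forall z' w' xi', Q (z', w') ->
       doubled z' w' - eps * v xi' - Lam * eps * psi (eps^-1 *: z'.1 - xi') - dist2 z' zh w' wh <=
       doubled z w - eps * v xi - Lam * eps * psi (eps^-1 *: z.1 - xi) - dist2 z zh w wh]].
Proof.
move=> [z0 [w0 [Q0 lt0]]].
have [||| [zh wh] Qh hmax] := @compact_EVT_max _ R cdoubled Q.
- by exists (z0, w0).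
- exact: compactQ.
- exact: continuous_subspaceT.
rewrite inE in Qh.
pose P := Lp *: reg_dir eta (zh.1 - wh.1).
have PL : enorm P <= Lp.
  by rewrite enormZ gtr0_norm// -[leRHS]mulr1 ler_pM2l// enorm_reg_dir.
have [v [cv pv vB supv]] := corrector PL.
pose Psi (y : ((V * R) * (V * R)) * V) : R :=
  cdoubled y.1 - eps * v y.2 - Lam * eps * psi (eps^-1 *: y.1.1.1 - y.2) - dist2 y.1.1 zh y.1.2 wh.
have c1 := @continuous_fst ((V * R) * (V * R))%type V.
have c2 := @continuous_snd ((V * R) * (V * R))%type V.
have c11 : continuous (fun y : ((V * R) * (V * R)) * V => y.1.1).
  exact: (continuous_compose (@continuous_fst _ _) c1).
have c12 : continuous (fun y : ((V * R) * (V * R)) * V => y.1.2).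
  exact: (continuous_compose (@continuous_snd _ _) c1).
have cx : continuous (fun y : ((V * R) * (V * R)) * V => y.1.1.1).
  exact: (continuous_compose (@continuous_fst _ _) c11).
have ct : continuous (fun y : ((V * R) * (V * R)) * V => y.1.1.2).
  exact: (continuous_compose (@continuous_snd _ _) c11).
have cy : continuous (fun y : ((V * R) * (V * R)) * V => y.1.2.1).
  exact: (continuous_compose (@continuous_fst _ _) c12).
have cs : continuous (fun y : ((V * R) * (V * R)) * V => y.1.2.2).
  exact: (continuous_compose (@continuous_snd _ _) c12).
have csq (f : ((V * R) * (V * R)) * V -> R) : continuous f -> continuous (fun y => f y ^+ 2).
  by move=> cf; exact: (continuous_mul cf cf).
have cPsi : continuous Psi.
  refine (continuous_sub (continuous_sub (continuous_sub _
    (continuous_mul (@continuous_const _ _ _) _)) (continuous_mul (@continuous_const _ _ _) _))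
    (continuous_add (continuous_add (continuous_add (csq _ _) (csq _ _)) (csq _ _)) (csq _ _))).
  - exact: (continuous_compose continuous_cdoubled c1).
  - exact: (continuous_compose cv c2).
  - apply: (continuous_compose (@continuous_psi R N)).
    exact: (continuous_vsub (continuous_scale cx) c2).
  - apply: (continuous_compose (@continuous_enorm R N)).
    exact: (continuous_vsub cx (@continuous_const _ _ _)).
  - exact: (continuous_sub ct (@continuous_const _ _ _)).
  - apply: (continuous_compose (@continuous_enorm R N)).
    exact: (continuous_vsub cy (@continuous_const _ _ _)).
  - exact: (continuous_sub cs (@continuous_const _ _ _)).
have [||| [[z w] xi] Qzw pmax] := @compact_EVT_max _ R Psi (Q `*` cube (N := N)).
- by exists ((z0, w0), 0); split => //; exact: cube0.
- by apply: compact_setX; [exact: compactQ|exact: compact_cube].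
- exact: continuous_subspaceT.
rewrite inE in Qzw; case: Qzw => /= Qzw _.
have {}pmax z' w' xi' : Q (z', w') ->
       doubled z' w' - eps * v xi' - Lam * eps * psi (eps^-1 *: z'.1 - xi') - dist2 z' zh w' wh <=
       doubled z w - eps * v xi - Lam * eps * psi (eps^-1 *: z.1 - xi) - dist2 z zh w wh.
  move=> Q'; have [kk xik] := to_cube xi'.
  have := pmax (z', w', xi' + map_mx (fun i : int => i%:~R) kk).
  rewrite inE => /(_ (conj Q' xik)).
  rewrite /Psi /= !cdoubledE//= pv.
  rewrite (_ : psi (_ - (xi' + _)) = psi (eps^-1 *: z'.1 - xi'))//.
  by rewrite -psiN -[RHS]psiN !opprB addrAC psi_periodic.
have vB1 := vB xi; have vB2 := vB (eps^-1 *: zh.1).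
have := pmax zh wh (eps^-1 *: zh.1) Qh.
rewrite subrr psi0 mulr0 subr0.
have -> : dist2 zh zh wh wh = 0 by rewrite /dist2 !subrr enorm0 expr0n !addr0.
have := hmax (z, w) (mem_set Qzw); rewrite !cdoubledE//=.
have := hmax (z0, w0) (mem_set Q0); rewrite !cdoubledE//=.
move: vB1 vB2; rewrite !ler_norml => /andP[a1 a2] /andP[b1 b2] h1 h2.
have a1' : - (eps * Bv) <= eps * v xi by rewrite -mulrN ler_pM2l.
have b2' : eps * v (eps^-1 *: zh.1) <= eps * Bv by rewrite ler_pM2l.
have p0 : 0 <= Lam * eps * psi (eps^-1 *: z.1 - xi) by rewrite !mulr_ge0 ?psi_ge0// ltW.
have d0 : 0 <= dist2 z zh w wh by rewrite /dist2 !addr_ge0// sqr_ge0.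
rewrite subr0 => h3.
move: lt0 eps_small p0 d0 => lt0 small p0 d0.
exists P, v, z, w, zh, wh, xi; split; [exact: PL|by split|exact: Qzw|by lra|].
split=> //; first by lra.
have : Lam * eps * psi (eps^-1 *: z.1 - xi) <= Lam * eps * ds.
  have : eps * (2 * Bv) <= eps * (Lam * ds) by rewrite ler_pM2l.
  by lra.
by rewrite ler_pM2l// mulr_gt0.
Qed.

Lemma doubling_contradiction :
  ~ (exists z w, Q (z, w) /\ l + 2 * Bv * eps < doubled z w).
Proof.
move=> /doubling_perturbed[P [v [z [w [zh [wh [xi]]]]]]].
move=> [PL [PE cv pv vB supv] Qzw lzw [dle psile pmax]].
have [[z1r z2T] [w1r w2T]] := Qzw.
rewrite /= in_itv/= in z2T; rewrite /= in_itv/= in w2T.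
have [zT wT zr wr zbeta] := interior z2T w2T lzw.
have /dist2_le[dx1 dt1 dy1 ds1] := dle.
pose q := Lam *: dpsi (eps^-1 *: z.1 - xi).
have q_sub : subdiff v xi q.
  have [C1 g1] := C1_psi (- Lam) (eps^-1 *: z.1).
  exists (fun x => - Lam * psi (x - eps^-1 *: z.1)); split=> //; last first.
    by rewrite g1 -opprB dpsiN scalerN scaleNr opprK.
  move=> y; have := pmax z w y Qzw.
  rewrite -(psiN (y - _)) -(psiN (xi - _)) !opprB => h.
  rewrite -(ler_pM2l eps_gt0); lra.
have corr := supv _ _ q_sub.
have dirN : reg_dir eta (w.1 - z.1) = - reg_dir eta (z.1 - w.1).
  by rewrite -opprB /reg_dir /reg_norm enormN scalerN.
have regN (y x : V) : reg_norm eta (y - x) = reg_norm eta (x - y) by rewrite /reg_norm enormBC.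
have open_z : open_strip T z by case/andP: zT => z0 z1; rewrite /open_strip/= z0 (lt_trans z1).
have open_w : open_strip T w by case/andP: wT => w0 w1; rewrite /open_strip/= w0 (lt_trans w1).
have sub : 2 * A * (z.2 - w.2) + 2 * (z.2 - zh.2) + k / (T - z.2) ^+ 2 +
    G (eps^-1 *: z.1) (Lp *: reg_dir eta (z.1 - w.1) + 2 * beta *: z.1 + q +
      2 *: (z.1 - zh.1)) <= 0.
  pose f x := Lp * reg_norm eta (x - w.1) + beta * enorm x ^+ 2 +
    Lam * eps * psi (eps^-1 *: x - xi) + enorm (x - zh.1) ^+ 2.
  pose g x := Lp *: reg_dir eta (x - w.1) + beta *: (2 *: x) +
    Lam * eps *: (eps^-1 *: dpsi (eps^-1 *: x - xi)) + 2 *: (x - zh.1).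
  have fg : has_grad f g.
    refine (has_gradD (has_gradD (has_gradD (has_gradZ _ _) (has_gradZ _ _)) (has_gradZ _ _)) _).
    - exact: has_grad_shift (has_grad_reg_norm eta_gt0).
    - exact: has_grad_sqr_enorm.
    - exact: has_grad_psi.
    - exact: has_grad_shift (@has_grad_sqr_enorm R N).
  have cid := @continuous_ident V.
  have csub (a : V) : continuous (fun x : V => x - a).
    exact: (continuous_vsub cid (@continuous_const _ _ _)).
  have cg : continuous g.
    refine (continuous_vadd (continuous_vadd (continuous_vadd (continuous_scale _)
      (continuous_scale (continuous_scale cid))) (continuous_scale (continuous_scale _)))
      (continuous_scale (csub _))).
    - exact: (continuous_compose (continuous_reg_dir eta_gt0) (csub _)).
    - apply: (continuous_compose (@continuous_dpsi R N)).
      exact: (continuous_vsub (continuous_scale cid) (@continuous_const _ _ _)).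
  have loc : \forall y \near z, W y - (f y.1 + time_penalty T 0 A w.2 1 zh.2 k y.2) <=
      W z - (f z.1 + time_penalty T 0 A w.2 1 zh.2 k z.2).
    have := near_time zr zT; apply: filterS => y [y1 y2].
    have := pmax y w xi; rewrite /doubled /dist2 /f /time_penalty => h.
    have {}h := h (conj (conj y1 y2) (conj w1r w2T)).
    by move: h; lra.
  have := subsolution_separated fg cg W_sub open_z loc.
  rewrite /dtime_penalty /g.
  have -> : beta *: (2 *: z.1) = 2 * beta *: z.1 by rewrite scalerA mulrC.
  have -> : Lam * eps *: (eps^-1 *: dpsi (eps^-1 *: z.1 - xi)) = q.
    by rewrite scalerA mulfK// gt_eqF.
  by rewrite !mulr1 add0r.
have sup : 0 <= 2 * A * (z.2 - w.2) - 2 * (w.2 - wh.2) +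
    F (Lp *: reg_dir eta (z.1 - w.1) - 2 *: (w.1 - wh.1)).
  pose f y := - (Lp * reg_norm eta (y - z.1) + enorm (y - wh.1) ^+ 2).
  pose g y := - (Lp *: reg_dir eta (y - z.1) + 2 *: (y - wh.1)).
  have fg : has_grad f g.
    refine (has_gradN (has_gradD (has_gradZ _ _) _)).
    - exact: has_grad_shift (has_grad_reg_norm eta_gt0).
    - exact: has_grad_shift (@has_grad_sqr_enorm R N).
  have csub (a : V) : continuous (fun x : V => x - a).
    exact: (continuous_vsub (@continuous_ident V) (@continuous_const _ _ _)).
  have cg : continuous g.
    refine (continuous_vopp (continuous_vadd (continuous_scale _) (continuous_scale (csub _)))).
    exact: (continuous_compose (continuous_reg_dir eta_gt0) (csub _)).
  have loc : \forall y \near w, u w - (f w.1 + time_penalty T 0 (- A) z.2 (-1) wh.2 0 w.2) <=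
      u y - (f y.1 + time_penalty T 0 (- A) z.2 (-1) wh.2 0 y.2).
    have := near_time wr wT; apply: filterS => y [y1 y2].
    have := pmax z y xi; rewrite /doubled /dist2 /f /time_penalty => h.
    have {}h := h (conj (conj z1r z2T) (conj y1 y2)).
    by move: h; rewrite (regN w.1 z.1) (regN y.1 z.1); lra.
  have := supersolution_separated fg cg u_super open_w loc.
  rewrite /dtime_penalty /g dirN scalerN opprD opprK mul0r addr0.
  by lra.
have Tk : k / T ^+ 2 <= k / (T - z.2) ^+ 2.
  case/andP: zT => z0 zT1; have Tz : 0 < T - z.2 by rewrite subr_gt0 (lt_trans zT1).
  rewrite ler_pM2l// lef_pV2 ?posrE ?exprn_gt0//; last by lra.
  by rewrite ler_pXn2r// ?nnegrE; lra.
have G1 := G_modulus (q + P) psile.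
set p1 := Lp *: reg_dir eta (z.1 - w.1) in sub sup.
have p1P : enorm (p1 - P) <= Lp * (2 / eta * (2 * d)).
  rewrite /p1 PE -scalerBr enormZ gtr0_norm// ler_pM2l//.
  apply: le_trans (reg_dir_lip eta_gt0 _ _) _.
  rewrite ler_pM2l ?divr_gt0//.
  rewrite (_ : z.1 - w.1 - (zh.1 - wh.1) = (z.1 - zh.1) - (w.1 - wh.1)).
    by apply: le_trans (enormB _ _) _; lra.
  by rewrite !opprB addrACA [RHS]addrACA; congr (_ + _); rewrite addrC.
have p1L : enorm p1 <= Lp.
  by rewrite /p1 enormZ gtr0_norm// -[leRHS]mulr1 ler_pM2l// enorm_reg_dir.
have en2 (a : V) : enorm a <= d -> enorm (2 *: a) <= 2 * d.
  by move=> ad; rewrite enormZ ger0_norm// ler_pM2l.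
have F1 := F_lip (P := p1 - 2 *: (w.1 - wh.1)) (Q := P).
have {}F1 : `|F (p1 - 2 *: (w.1 - wh.1)) - F P| <= M * (Lp * (2 / eta * (2 * d)) + 2 * d).
  apply: le_trans (F1 _ _) _.
  - apply: le_trans (enormB _ _) _; move: (en2 _ dy1) p1L d_small; lra.
  - by move: d_ge0 d_small PL; lra.
  - rewrite ler_wpM2l// addrAC; apply: le_trans (enormB _ _) _.
    by move: (en2 _ dy1) p1P; lra.
have G2 : `|G (eps^-1 *: z.1) (p1 + 2 * beta *: z.1 + q + 2 *: (z.1 - zh.1)) -
    G (eps^-1 *: z.1) (q + P)| <= M * (Lp * (2 / eta * (2 * d)) + db + 2 * d).
  apply: le_trans (G_lip _ _ _) _; rewrite ler_wpM2l//.
  have -> : p1 + 2 * beta *: z.1 + q + 2 *: (z.1 - zh.1) - (q + P) =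
      (p1 - P) + 2 * beta *: z.1 + 2 *: (z.1 - zh.1).
    by apply/rowP => i; rewrite !mxE; ring.
  apply: le_trans (enormD _ _) _; apply: lerD; last exact: en2.
  by apply: le_trans (enormD _ _) _; exact: lerD.
move: F1 G1 G2 dt1 ds1 gain corr sub sup Tk; rewrite !ler_norml.
move=> /andP[_ F1] /andP[G1 _] /andP[G2 _] /andP[t1 t2] /andP[s1 s2].
by lra.
Qed.

End Doubling.

Section UniformCorrectors.
Context (R : realType) (N : nat).
Local Notation V := 'rV[R]_N.
Context (G : V -> V -> R) (F : V -> R) (M Lp L1 : R).
Hypothesis M_ge0 : 0 <= M.
Hypothesis G_unif : torus_unif_cont G.
Hypothesis G_lip : forall x p q, `|G x p - G x q| <= M * enorm (p - q).
Hypothesis Lp_gt0 : 0 < Lp.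
Hypothesis Lp_lt : Lp < L1.
Hypothesis F_lip : forall P Q, enorm P <= L1 -> enorm Q <= L1 ->
  `|F P - F Q| <= M * enorm (P - Q).
Hypothesis corrector : forall P, enorm P <= L1 -> forall e, 0 < e ->
  exists v, [/\ continuous v, torus_periodic v
  & torus_supersolution (fun x p => G x (p + P) - (F P - e)) v].

Lemma compact_enorm_ball (r : R) : compact [set P : V | enorm P <= r].
Proof.
apply: (@subclosed_compact _ _ (box r)).
- have /continuous_closedP/(_ [set s : R | s <= r]) := @continuous_enorm R N.
  by apply; exact: closed_le.
- exact: compact_box.
- by move=> P; exact: enorm_box.
Qed.

Lemma uniform_corrector e : 0 < e -> exists2 B, 0 <= B &
  forall P, enorm P <= Lp -> exists v, [/\ continuous v, torus_periodic v,
    forall x, `|v x| <= B & torus_supersolution (fun x p => G x (p + P) - (F P - e)) v].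
Proof.
move=> e0; have e20 : 0 < e / 2 by rewrite divr_gt0.
pose good (B : R) (P : V) := enorm P <= Lp -> exists v, [/\ continuous v,
    torus_periodic v, forall x, `|v x| <= B
  & torus_supersolution (fun x p => G x (p + P) - (F P - e)) v].
have /compact_near_coveringP cov := @compact_enorm_ball Lp.
have near_good P : enorm P <= Lp ->
    \forall P' \near P & B \near +oo%R, good B P'.
  move=> PL; have [v [cv pv supv]] := corrector (le_trans PL (ltW Lp_lt)) e20.
  have [B0 vB] := torus_bounded cv pv.
  have M0 := M_ge0; have M40 : 0 < 4 * M + 1 by lra.
  near=> P' B.
  have B0B : B0 <= B by near: B; apply: nbhs_pinfty_ge; rewrite num_real.
  have PP' : enorm (P - P') < e / (4 * M + 1).
    near: P'.
    have ce : continuous (fun P' : V => enorm (P - P')).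
      apply: (continuous_compose (@continuous_enorm R N)).
      exact: (continuous_vsub (@continuous_const _ _ _) (@continuous_ident _)).
    have nb : nbhs (enorm (P - P)) (fun s => s < e / (4 * M + 1)).
      by apply: lt_nbhsl; rewrite subrr enorm0 divr_gt0.
    exact: (ce P _ nb).
  move=> P'L; exists v; split=> // [x|x p px]; first exact: le_trans (vB x) B0B.
  have h1 := supv _ _ px.
  have h2 := G_lip x (p + P) (p + P').
  have h3 := F_lip (le_trans P'L (ltW Lp_lt)) (le_trans PL (ltW Lp_lt)).
  have h4 : M * enorm (P - P') <= e / 4.
    have : enorm (P - P') * (4 * M + 1) < e by rewrite -ltr_pdivlMr.
    by have := enorm_ge0 (P - P'); lra.
  rewrite (_ : p + P - (p + P') = P - P') in h2; last first.
    by apply/rowP => i; rewrite !mxE; ring.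
  rewrite enormBC in h3.
  by move: h1 h2 h3; rewrite !ler_norml => h1 /andP[? ?] /andP[? ?]; lra.
have /(_ R (+oo%R) good _ near_good) covB := cov.
near (@pinfty_nbhs R) => B.
exists B; first by near: B; exact: nbhs_pinfty_ge.
have : [set P : V | enorm P <= Lp] `<=` good B by near: B; exact: covB.
by move=> h P PL; exact: h.
Unshelve. all: by end_near. Qed.

Lemma uniform_initial (T T2 r e : R) (u : V * R -> R) : 0 <= T2 < T -> 0 < e ->
  {within strip T, continuous u} ->
  exists2 d, 0 < d & forall y s, enorm y <= r -> 0 <= s <= T2 -> s < d ->
    `|u (y, s) - u (y, 0)| <= e.
Proof.
move=> T2T e0 cu; have T20 : 0 <= T2 by case/andP: T2T.
pose ut (y : V) (s : R) := u (y, clamp T2 s).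
have cut : continuous (fun z : V * R => ut z.1 z.2).
  exact: (continuous_clamp_strip T2T cu).
have cdiff : continuous (fun z : V * R => ut z.1 z.2 - ut z.1 0).
  refine (continuous_sub cut _).
  refine (continuous_compose (f := fun z : V * R => (z.1, 0 : R)) cut _).
  exact: (continuous_pairing (@continuous_fst _ _) (@continuous_const _ _ _)).
have /compact_near_coveringP cov := @compact_enorm_ball r.
pose good (s : R) (y : V) := `|ut y s - ut y 0| <= e.
have near_good y : enorm y <= r -> \forall y' \near y & s \near (0 : R), good s y'.
  move=> _; have /cvgrPdist_lt/(_ e e0) := cdiff (y, 0).
  rewrite /= subrr => h; apply: filterS h => -[y' s] /=.
  by rewrite sub0r normrN /good => /ltW.
have /(_ R (nbhs (0 : R)) good _ near_good) := cov.
move=> /nbhs_ballP[d /= d0 hd]; exists d => // y s yr /andP[s0 sT] sd.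
have := hd s; rewrite /ball/= sub0r normrN ger0_norm// => /(_ sd)/(_ y yr).
by rewrite /good /ut !clamp_id// ?lexx ?s0.
Qed.

End UniformCorrectors.

Lemma half_homogenization (R : realType) (N : nat) (G : 'rV[R]_N -> 'rV[R]_N -> R)
    (F : 'rV[R]_N -> R) (M Lp L1 T B0 c rho T3 tau : R)
    (u0 : 'rV[R]_N -> R) (u : 'rV[R]_N * R -> R) :
  0 <= M -> torus_unif_cont G ->
  (forall x p q, `|G x p - G x q| <= M * enorm (p - q)) -> 0 < Lp -> Lp < L1 ->
  (forall P Q, enorm P <= L1 -> enorm Q <= L1 -> `|F P - F Q| <= M * enorm (P - Q)) ->
  (forall P, enorm P <= L1 -> forall e, 0 < e -> exists v, [/\ continuous v,
    torus_periodic v & torus_supersolution (fun x p => G x (p + P) - (F P - e)) v]) ->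
  (forall x y, `|u0 x - u0 y| <= Lp * enorm (x - y)) -> (forall x, `|u0 x| <= B0) ->
  {within strip T, continuous u} -> (forall z, strip T z -> `|u z| <= B0) ->
  cauchy_supersolution T (fun _ p => F p) u -> (forall x, u (x, 0) = u0 x) ->
  0 <= c -> 0 <= T3 < T -> 0 < tau ->
  exists2 e0, 0 < e0 & forall eps, 0 < eps < e0 -> forall W,
    {within strip T, continuous W} ->
    cauchy_subsolution T (fun x p => G (eps^-1 *: x) p) W ->
    (forall x t, 0 <= t < T -> W (x, t) <= u0 x + c * t) ->
    forall x t, enorm x <= rho -> 0 <= t <= T3 -> W (x, t) - u (x, t) <= 4 * tau.
Proof.
move=> M0 G_unif G_lip Lp_gt0 Lp_lt F_lip corrector.
move=> u0L u0B cu uB supu uinit c0 /andP[T30 T3T] tau0.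
have B00 : 0 <= B0 by apply: le_trans (u0B 0).
have T0 : 0 < T by apply: le_lt_trans T30 T3T.
have cT0 : 0 <= c * T by rewrite mulr_ge0// ltW.
pose B := 2 * B0 + c * T + 4 * tau + 1.
have B_gt0 : 0 < B by rewrite /B; clear -B00 cT0 tau0; lra.
have tauB : tau < B by rewrite /B; clear -B00 cT0 tau0; lra.
pose eta := tau / Lp; have eta0 : 0 < eta by rewrite divr_gt0.
have Leta : Lp * eta = tau by rewrite /eta mulrC divfK// gt_eqF.
have TT3 : 0 < T - T3 by rewrite subr_gt0.
pose k := tau * (T - T3); have k0 : 0 < k by rewrite mulr_gt0.
pose g0 := k / T ^+ 2; have g00 : 0 < g0 by rewrite divr_gt0// exprn_gt0.
have M1 : 0 < M + 1 by clear -M0; lra.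
pose db := g0 / (8 * (M + 1)).
have db0 : 0 < db by rewrite divr_gt0// mulr_gt0.
have Mdb : M * db <= g0 / 8.
  have : db * (8 * (M + 1)) = g0 by rewrite /db divfK// gt_eqF// mulr_gt0.
  by clear -db0; lra.
have rho1 : 0 < rho ^+ 2 + 1 by rewrite ltr_wpDl// sqr_ge0.
pose beta := Num.min (tau / (rho ^+ 2 + 1)) (db ^+ 2 / (4 * B)).
have B4 : 0 < 4 * B by rewrite mulr_gt0.
have beta0 : 0 < beta by rewrite lt_min !divr_gt0// exprn_gt0.
have beta1 : beta * (rho ^+ 2 + 1) <= tau.
  by rewrite -ler_pdivlMr// /beta ge_min lexx.
have beta2 : beta * (4 * B) <= db ^+ 2.
  by rewrite -ler_pdivlMr// /beta ge_min lexx orbT.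
pose r1 := B / beta + 1; pose r2 := r1 + B / Lp + 1.
have Bbeta : 0 < B / beta by rewrite divr_gt0.
have BLp : 0 < B / Lp by rewrite divr_gt0.
have kB2 : 0 < k / (4 * B) by rewrite divr_gt0.
have kB1 : k / (2 * B) = 2 * (k / (4 * B)) by field; rewrite gt_eqF.
have kB : k / B = 4 * (k / (4 * B)) by field; rewrite gt_eqF.
have kBT : k / B < T - T3 by rewrite ltr_pdivrMr// /k mulrC ltr_pM2l.
pose T1 := T - k / (2 * B); pose T2 := T - k / (4 * B).
have T10 : 0 < T1 by rewrite /T1; clear -kB1 kB kB2 kBT T30; lra.
have T1T : T1 < T by rewrite /T1; clear -kB1 kB2; lra.
have T20 : 0 < T2 by rewrite /T2; clear -kB kB2 kBT T30; lra.
have T2T : T2 < T by rewrite /T2; clear -kB2; lra.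
have T3T1 : T3 < T1 by rewrite /T1; clear -kB1 kB kB2 kBT; lra.
have tau4 : 0 < tau / 4 by rewrite divr_gt0.
have T2itv : 0 <= T2 < T by rewrite (ltW T20).
have [du du0 initu] := uniform_initial r2 T2itv tau4 cu.
have c1 : 0 < 4 * (c + 1) by clear -c0; lra.
pose om := Num.min du (Num.min (k / (4 * B)) (tau / (4 * (c + 1)))).
have om0 : 0 < om by rewrite !lt_min du0 kB2 divr_gt0.
have om1 : om <= du by rewrite /om ge_min lexx.
have om2 : om <= k / (4 * B) by rewrite /om !ge_min lexx orbT.
have om3 : c * om <= tau / 4.
  have : om * (4 * (c + 1)) <= tau by rewrite -ler_pdivlMr// /om !ge_min lexx !orbT.
  by clear -om0; lra.
pose A := (B + 1) / om ^+ 2.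
have A0 : 0 < A by rewrite divr_gt0 ?exprn_gt0// addr_gt0.
have e10 : 0 < g0 / 8 by rewrite divr_gt0.
have [Bv Bv0 corrB] := uniform_corrector M0 G_lip Lp_lt F_lip corrector e10.
have [ds ds0 Gmod] := G_unif _ e10.
pose Lam := (2 * Bv + 1) / ds.
have Bv1 : 0 < 2 * Bv + 1 by rewrite ltr_wpDl// mulr_ge0.
have Lam0 : 0 < Lam by rewrite divr_gt0.
have LamE : 2 * Bv <= Lam * ds by rewrite /Lam divfK ?gt_eqF// lerDl.
pose C := 4 + M * (8 * (Lp / eta) + 4).
have C0 : 0 < C.
  have : 0 < Lp / eta by rewrite divr_gt0.
  by move=> h; rewrite ltr_wpDr// mulr_ge0// addr_ge0// mulr_ge0// ltW.
have C8 : 0 < 8 * C by rewrite mulr_gt0.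
pose d := Num.min ((L1 - Lp) / 2) (g0 / (8 * C)).
have d0 : 0 < d.
  by rewrite lt_min; apply/andP; split; apply: divr_gt0 => //; rewrite subr_gt0.
have d1 : Lp + 2 * d <= L1.
  have : d <= (L1 - Lp) / 2 by rewrite /d ge_min lexx.
  by clear; lra.
have d2 : d * C <= g0 / 8.
  have : d * (8 * C) <= g0 by rewrite -ler_pdivlMr// /d ge_min lexx orbT.
  by clear; lra.
have gain : 4 * d + 2 * (g0 / 8) +
    M * (2 * (Lp * (2 / eta * (2 * d)) + 2 * d) + db) < k / T ^+ 2.
  have -> : 4 * d + 2 * (g0 / 8) + M * (2 * (Lp * (2 / eta * (2 * d)) + 2 * d) + db) =
    d * C + g0 / 4 + M * db by rewrite /C; field; rewrite gt_eqF.
  by rewrite -/g0; clear -d2 Mdb g00; lra.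
pose e0 := Num.min (d ^+ 2) (tau / 4) / (2 * Bv + 1).
have min0 : 0 < Num.min (d ^+ 2) (tau / 4) by rewrite lt_min exprn_gt0.
exists e0 => [|eps /andP[eps0 epse0] W cW subW Wbar x t xrho /andP[t0 tT3]].
  by rewrite divr_gt0.
have epsB : 2 * Bv * eps < Num.min (d ^+ 2) (tau / 4).
  have : eps * (2 * Bv + 1) < Num.min (d ^+ 2) (tau / 4) by rewrite -ltr_pdivlMr.
  by clear -eps0; lra.
move: epsB; rewrite lt_min => /andP[epsd epstau].
rewrite leNgt; apply/negP => big.
have small_x (z : 'rV[R]_N) : beta * enorm z ^+ 2 < B -> enorm z < r1.
  move=> h; rewrite ltNge; apply/negP => r1z.
  have r11 : 1 <= r1 by rewrite /r1 lerDr ltW.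
  have : B / beta * beta = B by rewrite divfK// gt_eqF.
  have : r1 <= enorm z ^+ 2.
    have z1 : 1 <= enorm z := le_trans r11 r1z.
    by rewrite expr2; apply: le_trans r1z _; rewrite ler_peMl// enorm_ge0.
  move=> h1 h2; have : beta * r1 <= beta * enorm z ^+ 2 by rewrite ler_pM2l.
  by rewrite /r1; clear -h h2 beta0; lra.
have xB : beta * enorm x ^+ 2 <= tau.
  have : enorm x ^+ 2 <= rho ^+ 2.
    have rho0 : 0 <= rho by exact: le_trans (enorm_ge0 x) xrho.
    by rewrite ler_pXn2r// nnegrE enorm_ge0.
  move=> h; have : beta * enorm x ^+ 2 <= beta * rho ^+ 2 by rewrite ler_pM2l.
  by clear -beta1 beta0; lra.
have interior (z w : 'rV[R]_N * R) : 0 <= z.2 <= T1 -> 0 <= w.2 <= T2 ->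
    tau / 2 < doubled T W u Lp eta beta A k z w ->
    [/\ 0 < z.2 < T1, 0 < w.2 < T2, enorm z.1 < r1, enorm w.1 < r2
      & enorm (2 * beta *: z.1) <= db].
  case: z w => [y s] [y' s'] /= /andP[s0 sT] /andP[s'0 s'T].
  rewrite /doubled /= => hl.
  have sltT : s < T by exact: le_lt_trans sT T1T.
  have s'ltT : s' < T by exact: le_lt_trans s'T T2T.
  have Wys := Wbar y s; rewrite s0 sltT in Wys; have {}Wys := Wys isT.
  have uys := uB (y', s'); rewrite /strip/= s'0 s'ltT in uys; have {}uys := uys isT.
  have u0y := u0B y.
  have cs : c * s <= c * T by rewrite ler_wpM2l// ltW.
  have p1 : 0 <= Lp * reg_norm eta (y - y').
    by rewrite mulr_ge0 ?ltW// reg_norm_gt0.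
  have p2 : 0 <= beta * enorm y ^+ 2 by rewrite mulr_ge0 ?sqr_ge0// ltW.
  have p3 : 0 <= A * (s - s') ^+ 2 by rewrite mulr_ge0 ?sqr_ge0// ltW.
  have Ts : 0 < T - s by rewrite subr_gt0.
  have p4 : 0 < k / (T - s) by rewrite divr_gt0.
  move: (u0y) (uys); rewrite !ler_norml => /andP[_ q1] /andP[q2 _].
  have q3 : beta * enorm y ^+ 2 < B by rewrite /B; clear -hl Wys cs p1 p2 p3 p4 q1 q2 cT0 tau0; lra.
  have q4 : A * (s - s') ^+ 2 < B by rewrite /B; clear -hl Wys cs p1 p2 p3 p4 q1 q2 cT0 tau0; lra.
  have q5 : k / (T - s) < B by rewrite /B; clear -hl Wys cs p1 p2 p3 p4 q1 q2 cT0 tau0; lra.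
  have q6 : Lp * reg_norm eta (y - y') < B.
    by rewrite /B; clear -hl Wys cs p1 p2 p3 p4 q1 q2 cT0 tau0; lra.
  have yr1 := small_x _ q3.
  have y'r2 : enorm y' < r2.
    have h1 := @enorm_le_reg R N eta (y - y').
    have : reg_norm eta (y - y') < B / Lp by rewrite ltr_pdivlMr// mulrC.
    by have := enormB y (y - y'); rewrite subKr /r2; clear -h1 yr1; lra.
  have ss' : `|s - s'| < om.
    rewrite -(@ltr_pXn2r _ 2%N)// ?nnegrE ?normr_ge0 ?(ltW om0)//.
    rewrite real_normK ?num_real//.
    have : om ^+ 2 * A = B + 1 by rewrite /A mulrC divfK// gt_eqF// exprn_gt0.
    move=> h; rewrite -(ltr_pM2r A0) h mulrC; clear -q4; lra.
  have sT1 : s < T1.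
    have : k / B < T - s by rewrite ltr_pdivrMr// mulrC -ltr_pdivrMr.
    by rewrite /T1 kB1; clear -kB kB2; lra.
  have s'T2 : s' < T2.
    move: ss'; rewrite ltr_norml => /andP[h _].
    by rewrite /T2; move: sT1; rewrite /T1; clear -h om2 kB1; lra.
  have beta_y : enorm (2 * beta *: y) <= db.
    rewrite enormZ ger0_norm; last by rewrite mulr_ge0// ltW.
    rewrite -(@ler_pXn2r _ 2%N)// ?nnegrE ?(ltW db0)//; last first.
      by rewrite !mulr_ge0 ?enorm_ge0// ltW.
    have -> : (2 * beta * enorm y) ^+ 2 = beta * (4 * (beta * enorm y ^+ 2)) by ring.
    apply: le_trans beta2; rewrite ler_pM2l//; clear -q3; lra.
  have u0yy' : u0 y <= u0 y' + Lp * reg_norm eta (y - y').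
    have := u0L y y'; rewrite ler_norml => /andP[_ h].
    have : Lp * enorm (y - y') <= Lp * reg_norm eta (y - y').
      by rewrite ler_pM2l// enorm_le_reg.
    by clear -h; lra.
  have s_gt0 : 0 < s.
    rewrite lt_def s0 andbT; apply/eqP => sE; rewrite sE in ss' Wys hl p3 p4.
    rewrite sub0r normrN ger0_norm// in ss'.
    have := initu y' s' (ltW y'r2); rewrite s'0 s'T => /(_ isT (lt_le_trans ss' om1)).
    by rewrite uinit ler_norml => /andP[h _]; clear -h hl Wys p2 p3 p4 u0yy' tau0; lra.
  have s'_gt0 : 0 < s'.
    rewrite lt_def s'0 andbT; apply/eqP => sE; rewrite sE in ss' hl p3.
    rewrite subr0 ger0_norm// in ss'; rewrite uinit in hl.
    have : c * s <= c * om by rewrite ler_wpM2l// ltW.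
    by clear -hl Wys p2 p3 p4 u0yy' om3 tau0; lra.
  by split=> //; apply/andP; split.
apply: (doubling_contradiction M0 G_lip (r1 := r1) (r2 := r2) T10 T1T T20 T2T eps0
  cW cu subW supu Lp_gt0 eta0 k0 Lam0 F_lip corrB Gmod LamE (ltW d0)
  (ltW epsd) d1 gain interior).
have tT1 : t < T1 by exact: le_lt_trans tT3 T3T1.
exists (x, t), (x, t); split.
  have xr1 : enorm x < r1 by apply: small_x; exact: le_lt_trans xB tauB.
  split; (split; [apply: enorm_box|]) => /=; rewrite ?in_itv/= ?t0/=.
  - exact: ltW.
  - exact: ltW.
  - by rewrite /r2; clear -xr1 BLp; lra.
  - by move: tT1; rewrite /T1 /T2; clear -kB1 kB2; lra.
rewrite /doubled /= !subrr (reg_norm0 N eta0) expr0n mulr0 addr0 Leta.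
have : k / (T - t) <= tau.
  have Tt : 0 < T - t by rewrite subr_gt0 (lt_trans tT1).
  by rewrite ler_pdivrMr// /k ler_pM2l// lerD2l lerN2.
by clear -big xB epstau tau0; lra.
Qed.


(** * Reflection and conclusion *)

Section Reflection.
Context (R : realType) (N : nat).
Local Notation V := 'rV[R]_N.
Implicit Types (phi : V * R -> R) (z : V * R).

Lemma derivable_space phi z v : differentiable phi z ->
  derivable (fun x => phi (x, z.2)) z.1 v.
Proof.
move=> dphi; apply: diff_derivable.
apply: (@differentiable_comp _ _ _ _ (fun x : V => (x, z.2)) phi); last by case: z dphi.
by apply: differentiable_pair => //; exact: ex_diff.
Qed.

Lemma derivable_time phi z : differentiable phi z ->
  derivable (fun s => phi (z.1, s)) z.2 1.
Proof.
move=> dphi; apply: diff_derivable.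
apply: (@differentiable_comp _ _ _ _ (fun s : R => (z.1, s)) phi); last by case: z dphi.
by apply: differentiable_pair => //; exact: ex_diff.
Qed.

Lemma dxN phi z : differentiable phi z -> dx (fun w => - phi w) z = - dx phi z.
Proof.
move=> dphi; apply/rowP => i; rewrite !mxE.
have d : derivable (fun x => phi (x, z.2)) z.1 (delta_mx 0 i) by exact: derivable_space.
exact: (deriveN d).
Qed.

Lemma dtN phi z : differentiable phi z -> dt (fun w => - phi w) z = - dt phi z.
Proof.
move=> dphi; rewrite /dt !derive1E.
exact: (@deriveN _ _ _ (fun s : R => phi (z.1, s)) _ _ (derivable_time dphi)).
Qed.

Lemma near_open_strip (T : R) z : open_strip T z -> \forall w \near z, open_strip T w.
Proof.
move=> /andP[z0 zT].
have h2 : \forall w \near z, 0 < w.2.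
  have h : nbhs z.2 (fun s => 0 < s) by exact: lt_nbhsr.
  exact: (@continuous_snd _ _ z _ h).
have h3 : \forall w \near z, w.2 < T.
  have h : nbhs z.2 (fun s => s < T) by exact: lt_nbhsl.
  exact: (@continuous_snd _ _ z _ h).
by apply: filterS2 h2 h3 => w w0 wT; rewrite /open_strip/= w0.
Qed.

Lemma C1_stripN (T : R) phi : C1_strip T phi -> C1_strip T (fun w => - phi w).
Proof.
move=> C1 z zT; have [dphi cdx cdt] := C1 z zT; split.
- exact: differentiableN.
- rewrite /prop_for /continuous_at dxN//.
  apply: cvg_trans (cvgN cdx); apply: near_eq_cvg.
  have := near_open_strip zT; apply: filterS => w wT.
  by have [dw _ _] := C1 w wT; rewrite dxN.
- rewrite /prop_for /continuous_at dtN//.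
  apply: cvg_trans (cvgN cdt); apply: near_eq_cvg.
  have := near_open_strip zT; apply: filterS => w wT.
  by have [dw _ _] := C1 w wT; rewrite dtN.
Qed.

Lemma cauchy_supersolutionN (T : R) (F : V -> V -> R) (u : V * R -> R) :
  cauchy_subsolution T F u ->
  cauchy_supersolution T (fun x p => - F x (- p)) (fun z => - u z).
Proof.
move=> subu phi z C1 zT loc.
have := subu _ z (C1_stripN C1) zT.
have [dphi _ _] := C1 z zT; rewrite dtN// dxN// => h.
have : \forall w \near z, u w - - phi w <= u z - - phi z.
  by apply: filterS loc => w; lra.
by move=> /h; lra.
Qed.

Lemma cauchy_subsolutionN (T : R) (F : V -> V -> R) (u : V * R -> R) :
  cauchy_supersolution T F u ->
  cauchy_subsolution T (fun x p => - F x (- p)) (fun z => - u z).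
Proof.
move=> supu phi z C1 zT loc.
have := supu _ z (C1_stripN C1) zT.
have [dphi _ _] := C1 z zT; rewrite dtN// dxN// => h.
have : \forall w \near z, u z - - phi z <= u w - - phi w.
  by apply: filterS loc => w; lra.
by move=> /h; lra.
Qed.

Lemma within_continuousN (A : set (V * R)) (u : V * R -> R) :
  {within A, continuous u} -> {within A, continuous (fun z => - u z)}.
Proof. by move=> cu x; apply: cvgN; exact: cu. Qed.

End Reflection.

Section LipschitzConstant.
Context (R : realType) (N : nat).
Local Notation V := 'rV[R]_N.

Lemma lip_constP (f : V -> R) : (0 < N)%N -> elipschitz f ->
  0 <= lip_const f /\ forall x y, `|f x - f y| <= lip_const f * enorm (x - y).
Proof.
move=> N0 [L fL].
set S := [set `|f z.1 - f z.2| / enorm (z.1 - z.2) | z in [set z : V * V | z.1 != z.2]].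
have enorm_gt0 (x y : V) : x != y -> 0 < enorm (x - y).
  by move=> xy; rewrite lt_def enorm_ge0 enorm_eq0 subr_eq0 xy.
have S0 : S !=set0.
  exists (`|f (const_mx 1) - f 0| / enorm (const_mx 1 - 0 : V)).
  exists (const_mx 1, 0) => //=; apply/eqP => /rowP/(_ (Ordinal N0)).
  by rewrite !mxE => /eqP; rewrite oner_eq0.
have Ssup : has_sup S.
  split=> //; exists L => _ [[x y] /= xy <-].
  by rewrite ler_pdivrMr ?enorm_gt0.
have SP x y : x != y -> `|f x - f y| / enorm (x - y) <= lip_const f.
  by move=> xy; apply: (sup_upper_bound Ssup); exists (x, y).
split.
  have [_ [[x y] /= xy _]] := S0; apply: le_trans (SP _ _ xy).
  by rewrite divr_ge0// enorm_ge0.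
move=> x y; have [->|xy] := eqVneq x y; first by rewrite !subrr normr0 enorm0 mulr0.
by rewrite -ler_pdivrMr ?enorm_gt0// SP.
Qed.

Lemma compact_strip_bounds (T : R) (K : set (V * R)) : 0 < T -> compact K ->
  K `<=` strip T -> exists rho T3, 0 <= T3 < T /\
    forall z, K z -> enorm z.1 <= rho /\ 0 <= z.2 <= T3.
Proof.
move=> T0 cK KT; have [K0|/nonemptyPn K0] := pselect (K !=set0); last first.
  by exists 0, 0; split=> [|z]; [rewrite lexx|rewrite K0].
have c1 : continuous (fun z : V * R => enorm z.1).
  exact: (continuous_compose (@continuous_enorm R N) (@continuous_fst _ _)).
have [z1 _ hz1] := compact_EVT_max K0 cK (continuous_subspaceT c1).
have [z2 z2K hz2] := compact_EVT_max K0 cK (continuous_subspaceT (@continuous_snd V R)).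
rewrite inE in z2K; exists (enorm z1.1), z2.2; split; first exact: KT.
move=> z Kz; split; first by apply: hz1; rewrite inE.
by have /andP[-> _] := KT _ Kz; apply: hz2; rewrite inE.
Qed.

Lemma uniform_cvg_at_right (K : set (V * R)) (f : R -> V * R -> R) (u : V * R -> R) :
  (forall e, 0 < e -> exists2 e0, 0 < e0 &
     forall eps, 0 < eps < e0 -> forall z, K z -> `|f eps z - u z| < e) ->
  {uniform K, f eps @[eps --> 0^'+] --> u}.
Proof.
move=> h U /uniform_nbhs[E [entE EU]].
have [e /= e0 eE] := entE.
have [d d0 hd] := h e e0.
apply/nbhs_ballP; exists d => //= eps; rewrite /ball/= sub0r normrN => epsd eps0.
apply: EU => z Kz; apply: eE; rewrite /= /ball/= distrC; apply: hd => //.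
by rewrite eps0; move: epsd; rewrite gtr0_norm.
Qed.

End LipschitzConstant.

Section Specialization.
Context (R : realType) (N : nat).
Local Notation V := 'rV[R]_N.

Lemma bounded_near_bound (X : Type) (f : X -> R) (A : set X) :
  [bounded f x | x in A] -> exists B, forall x, A x -> `|f x| <= B.
Proof.
by move=> [B [_ hB]]; exists (B + 1) => x Ax; apply: (hB _ _ x Ax); rewrite ltrDl.
Qed.

Lemma lipschitz_on_nonneg (m : R -> R) : [lipschitz m r | r in [set r : R | 0 <= r]] ->
  exists2 L, 0 <= L & forall r s, 0 <= r -> 0 <= s -> `|m r - m s| <= L * `|r - s|.
Proof.
move=> [L [_ hL]]; exists (Num.max L 0 + 1) => [|r s r0 s0].
  by rewrite addr_ge0// le_max lexx orbT.
have LL : L < Num.max L 0 + 1 by rewrite ltr_pwDr// le_max lexx.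
exact: (hL _ LL (r, s) (conj r0 s0)).
Qed.

End Specialization.

Theorem theorem5p1 (R : realType) (N : nat) (N_gt0 : (0 < N)%N)
    (sigma : 'rV[R]_N -> R) (m : R -> R)
    (sigma_periodic : torus_periodic sigma)
    (sigma_continuous : continuous sigma)
    (sigma_gt0 : forall x, 0 < sigma x)
    (m_range : forall r : R, 0 <= r -> 0 < m r < 1)
    (m_lipschitz : [lipschitz m r | r in [set r : R | 0 <= r]])
    (m_increasing : forall r s : R, 0 <= r -> r < s -> m r < m s)
    (m_limit : m r @[r --> +oo] --> (1 : R))
    (H : 'rV[R]_N -> 'rV[R]_N -> R)
    (H_def : forall x p, H x p = sigma x * m (enorm p))
    (Hinf : 'rV[R]_N -> R)
    (Hinf_def : generalized_effective_hamiltonian H Hinf)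
    (T : R) (T_gt0 : 0 < T)
    (u0 : 'rV[R]_N -> R)
    (u0_bounded : [bounded u0 x | x in [set: 'rV[R]_N]])
    (u0_lipschitz : elipschitz u0)
    (alternative : solvability_set H = [set: 'rV[R]_N] \/
       m (lip_const u0) < inf (range sigma) / sup (range sigma))
    (ueps : R -> 'rV[R]_N * R -> R)
    (ueps_solution : forall eps : R, 0 < eps ->
       bounded_cauchy_solution T (fun x p => H (eps^-1 *: x) p) u0 (ueps eps))
    (u : 'rV[R]_N * R -> R)
    (u_solution : bounded_cauchy_solution T (fun _ p => Hinf p) u0 u) :
  forall K : set ('rV[R]_N * R), compact K -> K `<=` strip T ->
    {uniform K, ueps eps @[eps --> 0^'+] --> u}.
Proof.
have HE : H = ham sigma m by apply/funext => x; apply/funext => p; exact: H_def.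
rewrite HE in Hinf_def alternative ueps_solution.
pose smax := sup (range sigma); pose smin := inf (range sigma).
have [xM sigma_max] := torus_max sigma_continuous sigma_periodic.
have [xm sigma_min] : exists x, forall y, sigma x <= sigma y.
  have pN : torus_periodic (fun x => - sigma x) by move=> x k; rewrite sigma_periodic.
  have cN := continuous_vopp sigma_continuous.
  by have [x hx] := torus_max cN pN; exists x => y; have := hx y; rewrite lerN2.
have range0 : range sigma !=set0 by exists (sigma 0), 0.
have sigma_le x : sigma x <= smax.
  apply: sup_upper_bound; last by exists x.
  by split=> //; exists (sigma xM) => _ [y _ <-].
have sigma_ge x : smin <= sigma x.
  apply: ge_inf; last by exists x.
  by exists (sigma xm) => _ [y _ <-].
have smin_gt0 : 0 < smin.
  apply: lt_le_trans (sigma_gt0 xm) _.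
  by apply: lb_le_inf => // _ [y _ <-].
have smax_gt0 : 0 < smax by exact: lt_le_trans (sigma_gt0 0) (sigma_le 0).
have [Lm Lm0 m_lip] := lipschitz_on_nonneg m_lipschitz.
have m_mono r s : 0 <= r -> r <= s -> m r <= m s.
  move=> r0; rewrite le_eqVlt => /predU1P[->//|rs].
  by apply: ltW; exact: m_increasing.
have [L0 u0L] := lip_constP N_gt0 u0_lipschitz.
set L := lip_const u0 in L0 u0L alternative.
have [L1 LL1 L1_corr] : exists2 L1, L < L1 &
    forall P, enorm P <= L1 -> has_corrector sigma m Hinf P.
  case: alternative => [allD|mL].
    exists (L + 1) => [|P _]; first by rewrite ltrDl.
    apply: (solvable_corrector sigma_periodic sigma_continuous sigma_gt0 sigma_le
      m_range Lm0 m_lip Hinf_def).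
    by rewrite allD.
  rewrite -/smin -/smax ltr_pdivlMr// mulrC in mL.
  pose d := (smin - smax * m L) / (2 * (smax * Lm + 1)).
  have sL0 : 0 <= smax * Lm by rewrite mulr_ge0// ltW.
  have gap0 : 0 < smin - smax * m L by rewrite subr_gt0.
  have d0 : 0 < d by rewrite divr_gt0// mulr_gt0// ltr_wpDl.
  have dE : d * (2 * (smax * Lm + 1)) = smin - smax * m L.
    by rewrite /d divfK// gt_eqF// mulr_gt0// ltr_wpDl.
  exists (L + d) => [|P PL]; first by rewrite ltrDl.
  apply: (small_slope_corrector sigma_periodic sigma_continuous sigma_gt0 sigma_le
    sigma_ge smin_gt0 m_range Lm0 m_lip m_mono m_limit Hinf_def).
  have Ld0 : 0 <= L + d by rewrite addr_ge0// ltW.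
  have := m_lip _ _ Ld0 L0; rewrite addrAC subrr add0r (gtr0_norm d0) ler_norml.
  move=> /andP[_ mLd].
  have h1 : smax * m (enorm P) <= smax * m (L + d).
    by rewrite ler_pM2l//; apply: m_mono => //; exact: enorm_ge0.
  have h2 : smax * m (L + d) <= smax * (m L + Lm * d).
    by rewrite ler_pM2l//; clear -mLd; lra.
  by clear -h1 h2 dE d0 gap0; lra.
have [B1 u0B] := bounded_near_bound u0_bounded.
have [cu ub subu supu uinit] := u_solution.
have [B2 uB] := bounded_near_bound ub.
pose B := Num.max B1 B2.
pose Lp := (L + L1) / 2.
have Lp0 : 0 < Lp by clear -L0 LL1; rewrite /Lp; lra.
have LLp : L <= Lp by clear -LL1; rewrite /Lp; lra.
have LpL1 : Lp < L1 by clear -LL1; rewrite /Lp; lra.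
pose M := smax * Lm.
have M0 : 0 <= M by rewrite mulr_ge0// ltW.
have G_unif := ham_unif_cont sigma_periodic sigma_continuous m_range.
have G_lip := ham_lip sigma_gt0 sigma_le Lm0 m_lip.
have F_lip P Q : enorm P <= L1 -> enorm Q <= L1 -> `|Hinf P - Hinf Q| <= M * enorm (P - Q).
  move=> PL QL; exact: (Hinf_lipschitz sigma_periodic sigma_continuous sigma_gt0 sigma_le
    m_range Lm0 m_lip (L1_corr _ PL) (L1_corr _ QL)).
have u0Lp x y : `|u0 x - u0 y| <= Lp * enorm (x - y).
  by apply: le_trans (u0L x y) _; rewrite ler_wpM2r// enorm_ge0.
have u0B' x : `|u0 x| <= B by rewrite le_max u0B.
have uB' z : strip T z -> `|u z| <= B by move=> /uB h; rewrite le_max h orbT.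
have ham_itv x p : 0 <= ham sigma m x p <= smax.
  have /andP[m0 m1] := m_range _ (enorm_ge0 p).
  apply/andP; split; first by rewrite mulr_ge0 ?ltW.
  by rewrite /ham -[leRHS]mulr1; apply: ler_pM => //; exact: ltW.
have smax0 := ltW smax_gt0.
move=> K cK KT; have [rho [T3 [T3T Kb]]] := compact_strip_bounds T_gt0 cK KT.
apply: uniform_cvg_at_right => e e0.
pose tau := e / 8; have tau0 : 0 < tau by rewrite divr_gt0.
have corr P : enorm P <= L1 -> forall e, 0 < e -> exists v, [/\ continuous v,
    torus_periodic v & torus_supersolution (fun x p => ham sigma m x (p + P) - (Hinf P - e)) v].
  by move=> PL e' e'0; have [v [cv pv _ supv]] := L1_corr _ PL _ e'0; exists v.
have [ea ea0 upper] := half_homogenization rho M0 G_unif G_lip Lp0 LpL1 F_lip corr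
  u0Lp u0B' cu uB' supu uinit smax0 T3T tau0.
pose G' (x p : 'rV[R]_N) := - ham sigma m x (- p).
pose F' (P : 'rV[R]_N) := - Hinf (- P).
have G'_unif : torus_unif_cont G'.
  move=> eta /G_unif[d d0 h]; exists d => // x y p xy.
  by rewrite /G' -opprD normrN; exact: h.
have G'_lip x p q : `|G' x p - G' x q| <= M * enorm (p - q).
  by rewrite /G' -opprD normrN -[enorm (p - q)]enormN opprD; exact: G_lip.
have F'_lip P Q : enorm P <= L1 -> enorm Q <= L1 -> `|F' P - F' Q| <= M * enorm (P - Q).
  move=> PL QL; rewrite /F' -opprD normrN -[enorm (P - Q)]enormN opprD.
  by apply: F_lip; rewrite enormN.
have corr' P : enorm P <= L1 -> forall e, 0 < e -> exists v, [/\ continuous v,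
    torus_periodic v & torus_supersolution (fun x p => G' x (p + P) - (F' P - e)) v].
  move=> PL e' e'0; have PL' : enorm (- P) <= L1 by rewrite enormN.
  have [v [cv pv subv _]] := L1_corr _ PL' _ e'0.
  exists (fun x => - v x); split.
  - exact: continuous_vopp.
  - by move=> x k; rewrite pv.
  - move=> x p px; have /subv : superdiff v x (- p).
      have := @superdiffN _ _ (fun y => - v y) x (- p); rewrite opprK => -[_ /(_ px)].
      by under eq_fun do rewrite opprK.
    by move=> /= h; rewrite /G' /F' (opprD p P); clear -h; lra.
have u0NLp x y : `|- u0 x - - u0 y| <= Lp * enorm (x - y) by rewrite -opprD normrN.
have u0NB x : `|- u0 x| <= B by rewrite normrN.
have uNB z : strip T z -> `|- u z| <= B by rewrite normrN; exact: uB'.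
have uNinit x : - u (x, 0) = - u0 x by rewrite uinit.
have [eb eb0 lower] := half_homogenization rho M0 G'_unif G'_lip Lp0 LpL1 F'_lip corr'
  u0NLp u0NB (within_continuousN cu) uNB (cauchy_supersolutionN subu) uNinit smax0 T3T tau0.
exists (Num.min ea eb) => [|eps /andP[eps0]]; first by rewrite lt_min ea0.
rewrite lt_min => /andP[epsa epsb] [x t] Kxt.
have [/= xrho tT3] := Kb _ Kxt.
have [cw wb subw supw winit] := ueps_solution _ eps0.
have [B3 wB] := bounded_near_bound wb.
have barrier := time_barrier subw cw wB (ltW Lp0) u0Lp winit smax0.
have {}barrier : forall x t, 0 <= t < T -> ueps eps (x, t) <= u0 x + smax * t.
  apply: barrier => y p; have /andP[h _] := ham_itv (eps^-1 *: y) p.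
  by rewrite (le_trans _ h)// oppr_le0.
have subwN := cauchy_subsolutionN supw.
have wNB z : strip T z -> `|- ueps eps z| <= B3 by rewrite normrN; exact: wB.
have wNinit y : - ueps eps (y, 0) = - u0 y by rewrite winit.
have cwN := within_continuousN cw.
have barrierN := time_barrier subwN cwN wNB (ltW Lp0) u0NLp wNinit smax0.
have {}barrierN : forall x t, 0 <= t < T -> - ueps eps (x, t) <= - u0 x + smax * t.
  apply: barrierN => y p; have /andP[_ h] := ham_itv (eps^-1 *: y) (- p).
  by rewrite lerN2.
have epsa' : 0 < eps < ea by rewrite eps0.
have epsb' : 0 < eps < eb by rewrite eps0.
have up := upper _ epsa' _ cw subw barrier _ _ xrho tT3.
have lo := lower _ epsb' _ cwN subwN barrierN _ _ xrho tT3.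
rewrite ltr_norml; clear -up lo e0; rewrite /tau in up lo.
by apply/andP; split; lra.
Qed.
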